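(* Let $V$ be a $\mathbb{Z}^n$-graded vector space. The $\mathbb{Z}^n$-graded vector space $C(V)=\bigoplus_{Q\in\mathbb{Z}^n}\prod_{p\ge1}M^{(Q+(1-p)e_1,p-1)}(V)$ is a $\mathbb{Z}^n$-graded Lie algebra for the bracket $$[\pi,\rho]^{\bar\otimes}=\phi^{-1}[\phi\pi,\phi\rho]=\sum_{q\ge1}\sum_{s+t=q+1}(-1)^{1+(s-1)\langle e_1,\rho\rangle}[\pi_s,\rho_t]^{\otimes},$$ where $\pi=\sum_s\pi_s\in C^\pi(V)$ and $\rho=\sum_t\rho_t\in C^\rho(V)$ are two homogeneous elements of $C(V)$ of $\mathbb{Z}^n$-degree $\pi$ and $\rho$ respectively.
   Context: Vector spaces are over a field $\mathbb{K}$ of characteristic $0$; for $\alpha,\beta\in\mathbb{Z}^m$, $\langle\alpha,\beta\rangle=\sum_i\alpha_i\beta_i$. A homogeneous vector or map and its degree/weight are denoted by the same symbol; $e_1=(1,0,\ldots,0)\in\mathbb{Z}^n$. A $\mathbb{Z}^m$-graded Lie algebra has a weight $0$ bracket with $[a,b]=-(-1)^{\langle a,b\rangle}[b,a]$ and $[a,[b,c]]=[[a,b],c]+(-1)^{\langle a,b\rangle}[b,[a,c]]$. $M^{(A,a)}(V)$, $a\ge0$, is the space of $(a+1)$-linear maps $V^{\times(a+1)}\to V$ of weight $A\in\mathbb{Z}^n$; $C^Q(V)=\prod_{p\ge1}M^{(Q+(1-p)e_1,p-1)}(V)$; elements are sequences $\pi=(\pi_1,\pi_2,\ldots)=\sum_p\pi_p$,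 $\pi_p$ being $p$-linear. Indices $s,t$ are $\ge1$. Tensor coalgebra. For a graded space $W$, $T(W)=\bigoplus_{p\ge1}W^{\otimes p}$, $\mathbb{Z}^n$-graded by total degree, with coproduct $\Delta(w_1\otimes\ldots\otimes w_p)=\sum_{I\cup J=N^{(p-1)},\,I\ne\emptyset}\varepsilon_W(I;J)W_I\bigotimes W_J\otimes w_p$. Here $N^{(p)}=(1,\ldots,p)$, $I,J$ are disjoint naturally ordered subsets with the given union, $W_I=w_{i_1}\otimes\ldots\otimes w_{i_{|I|}}$, and $\varepsilon_W(I;J)$ is the Koszul sign of the rearrangement of $(W_I,W_J)$ into increasing index order. Tensor products of maps: $(f\otimes g)(v_1\otimes v_2)=(-1)^{\langle g,v_1\rangle}f(v_1)\otimes g(v_2)$. A weight $Q$ coderivation is a weight $Q$ linear map with $\Delta Q=(Q\otimes\mathrm{id}+\mathrm{id}\otimes Q)\Delta$; $\mathrm{CoDer}(T(W))=\bigoplus_Q\mathrm{CoDer}^Q(T(W))$ is a $\mathbb{Z}^n$-graded Lie algebra for the graded commutator $[Q,Q']=QQ'-(-1)^{\langle Q,Q'\rangle}Q'Q$. A weight $Q$ coderivation is uniquely determined by its corestrictions $Q_p:W^{\otimes p}\hookrightarrow T(W)\xrightarrow{Q}T(W)\to W$, which can be arbitrary weight $Q$ maps, via $$Q(w_1\otimes\ldots\otimes w_p)=\sum_{I\cup J\cup K=N^{(p)},\;I,J<K}\varepsilon_W(I;J)(-1)^{\langle Q,W_I\rangle}W_I\otimes Q_{|J|+1}(W_J\otimes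 w_{k_1})\otimes W_{K\setminus k_1},$$ with $I,J$ possibly empty, $K=(k_1<k_2<\ldots)$ nonempty, and $I<K$ meaning that the last element of $I$ is smaller than $k_1$. Desuspension. $\downarrow V$ is $V$ with grading $(\downarrow V)^\alpha=V^{\alpha+e_1}$; $\downarrow:V\to\downarrow V$ has weight $-e_1$ and inverse $\uparrow$; $\uparrow^{\otimes p}=\uparrow\otimes\ldots\otimes\uparrow$ with the sign convention $(f\otimes g)(v_1\otimes v_2)=(-1)^{\langle g,v_1\rangle}f(v_1)\otimes g(v_2)$ for tensor products of maps. The weight $0$ isomorphism $\phi:C(V)\to\mathrm{CoDer}(T(\downarrow V))$ sends $\pi\in C^Q(V)$ to the weight $Q$ coderivation with corestrictions $Q_p=(-1)^{\frac{p(p-1)}{2}}\downarrow\circ\pi_p\circ\uparrow^{\otimes p}$, $p\ge1$. For $A\in M^{(A,a)}(V)$, $\phi_{(A,a)}(A)$ denotes the weight $A+ae_1$ coderivation whose only (possibly) nonzero corestriction is $(-1)^{\frac{a(a+1)}{2}}\downarrow\circ A\circ\uparrow^{\otimes(a+1)}$. The $\mathbb{Z}^{n+1}$-graded stem bracket of $A\in M^{(A,a)}(V)$, $B\in M^{(B,b)}(V)$ is $[A,B]^\otimes:=(-1)^{1+\langle ae_1,be_1+B\rangle}\phi^{-1}_{(A+B,a+b)}([\phi_{(A,a)}(A),\phi_{(B,b)}(B)])\in M^{(A+B,a+b)}(V)$. *)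

(* Defs.v *)
From HB Require Import structures.
From mathcomp Require Import all_boot all_order all_algebra.
From mathcomp Require Import mathcomp_extra boolp classical_sets functions.
From mathcomp Require Import cardinality fsbigop.

Set Implicit Arguments.
Unset Strict Implicit.
Unset Printing Implicit Defensive.

Import GRing.Theory.
Local Open Scope classical_set_scope.
Local Open Scope ring_scope.


Section LinearAlgebra.
Variable K : fieldType.

Definition submodule (E : lmodType K) (B : set E) : Prop :=
  B 0 /\ forall c x y, B x -> B y -> B (c *: x + y).

Definition linspan (E : lmodType K) (A : set E) : set E :=
  smallest (@submodule E) A.

Lemma submodule_linspan (E : lmodType K) (A : set E) : submodule (linspan A).
Proof.
split=> [B [[B0 _] _] //|c x y Ax Ay B AB].
by have [[_ BD] _] := AB; apply: BD; [exact: Ax | exact: Ay].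
Qed.

Lemma submodule_closed (E : lmodType K) (B : set E) :
  submodule B -> submod_closed [pred x | `[< B x >]].
Proof.
move=> [B0 BD]; split=> [|c x y /asboolP Bx /asboolP By]; apply/asboolP => //.
exact: BD.
Qed.

Section Quotient.
Variables (E : lmodType K) (A : set E).

Definition in_linspan : {pred E} := [pred x | `[< linspan A x >]].

HB.instance Definition _ := GRing.isSubmodClosed.Build K E in_linspan
  (submodule_closed (submodule_linspan A)).

Definition modquot := {ideal_quot in_linspan}.
HB.instance Definition _ := GRing.Zmodule.on modquot.

Definition modquot_pi (x : E) : modquot := \pi_({ideal_quot in_linspan})%qT x.

Definition modquot_scale (c : K) (x : modquot) : modquot :=
  modquot_pi (c *: repr (x : {ideal_quot in_linspan})).

Lemma modquot_piP x y : modquot_pi x = modquot_pi y <-> linspan A (x - y).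
Proof.
split=> [/eqP|h]; last apply/eqP.
  by rewrite -[_ == _]Quotient.idealrBE => /asboolP.
by rewrite -[_ == _]Quotient.idealrBE; apply/asboolP.
Qed.

Lemma modquot_piK (x : modquot) :
  modquot_pi (repr (x : {ideal_quot in_linspan})) = x.
Proof. exact: reprK. Qed.

Lemma modquot_piD x y : modquot_pi (x + y) = modquot_pi x + modquot_pi y.
Proof. exact: Quotient.pi_add. Qed.

Lemma modquot_piZ c x : modquot_pi (c *: x) = modquot_scale c (modquot_pi x).
Proof.
apply/modquot_piP; rewrite -scalerBr -[X in linspan A X]addr0.
have [L0 LD] := submodule_linspan A; apply: LD => //; apply/modquot_piP.
by rewrite modquot_piK.
Qed.

Fact modquot_scaleA c d x :
  modquot_scale c (modquot_scale d x) = modquot_scale (c * d) x.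
Proof. by rewrite -[x]modquot_piK -!modquot_piZ scalerA. Qed.
Fact modquot_scale1 : left_id 1 modquot_scale.
Proof. by move=> x; rewrite -[x]modquot_piK -modquot_piZ scale1r. Qed.
Fact modquot_scaleDr : right_distributive modquot_scale +%R.
Proof.
move=> c x y; rewrite -[x]modquot_piK -[y]modquot_piK -modquot_piD.
by rewrite -!modquot_piZ scalerDr modquot_piD.
Qed.
Fact modquot_scaleDl x : {morph modquot_scale^~ x : c d / c + d}.
Proof.
by move=> c d; rewrite -[x]modquot_piK -!modquot_piZ scalerDl modquot_piD.
Qed.

HB.instance Definition _ := GRing.Zmodule_isLmodule.Build K modquot
  modquot_scaleA modquot_scale1 modquot_scaleDr modquot_scaleDl.
End Quotient.

Definition finsupp (I : Type) (E : zmodType) (f : I -> E) : Prop :=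
  finite_set [set i | f i <> 0].

Lemma finsupp_submodule (I : Type) (E : lmodType K) :
  submodule [set f : I -> E | finsupp f].
Proof.
split=> [|c f g /= fF gF].
  by apply: sub_finite_set (finite_set0 I) => i /= /(_ erefl).
have fgF : finite_set ([set i | f i <> 0] `|` [set i | g i <> 0]).
  by rewrite finite_setU.
apply: sub_finite_set fgF => i /=; have [fi|fi _] := pselect (f i = 0).
  by rewrite fctE /= {1}/GRing.scale /= fi scaler0 add0r; right.
by left.
Qed.

Section Free.
Variable X : Type.

Definition freemod_pred : {pred X -> K^o} := [pred f | `[< finsupp f >]].

HB.instance Definition _ := GRing.isSubmodClosed.Build K (X -> K^o) freemod_pred
  (submodule_closed (finsupp_submodule X K^o)).

Record freemod := Freemod { freemod_val :> X -> K^o; _ : freemod_val \in freemod_pred }.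

HB.instance Definition _ := [isSub for freemod_val].
HB.instance Definition _ := [Choice of freemod by <:].
HB.instance Definition _ := [SubChoice_isSubLmodule of freemod by <:].

Fact gen_subproof (x : X) :
  (fun y => if `[< y = x >] then 1 else 0 : K^o) \in freemod_pred.
Proof.
apply/asboolP; apply: sub_finite_set (finite_set1 x) => y /=.
by case: asboolP.
Qed.

Definition gen (x : X) : freemod := Freemod (gen_subproof x).
End Free.


Section Tensor.
Variables A B : lmodType K.

Definition bilinear_rel : set (freemod (A * B)) :=
  [set r | exists c x y z, r = gen (c *: x + y, z) - (c *: gen (x, z) + gen (y, z))]
  `|`
  [set r | exists c x y z, r = gen (z, c *: x + y) - (c *: gen (z, x) + gen (z, y))].

Definition tensor : lmodType K := modquot bilinear_rel.

Definition tprod (x : A) (y : B) : tensor := modquot_pi bilinear_rel (gen (x, y)).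
End Tensor.

Section TensorCoalgebra.
Variable W : lmodType K.

(* The sum over p >= 1 of the p-th tensor powers of W, generated by all words
   in W modulo linearity in each letter; the empty word is killed since p >= 1. *)
Definition multilinear_rel : set (freemod (seq W)) :=
  [set gen [::]]
  `|`
  [set r | exists u v c x y, r = gen (u ++ (c *: x + y) :: v)
      - (c *: gen (u ++ x :: v) + gen (u ++ y :: v))].

Definition tens_alg : lmodType K := modquot multilinear_rel.

Definition tens (w : seq W) : tens_alg := modquot_pi multilinear_rel (gen w).

Definition is_corestr (p : tens_alg -> W) : Prop :=
  [/\ linear p, forall x, p (tens [:: x]) = x
    & forall w, size w != 1%N -> p (tens w) = 0].

Definition corestr : tens_alg -> W := xget 0 is_corestr.
End TensorCoalgebra.

End LinearAlgebra.


Section Graded.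
Variables (K : fieldType) (m : nat).
Local Notation Z := 'rV[int]_m.

Definition ip (a b : Z) : int := \sum_i a 0 i * b 0 i.

Definition sgn (k : int) : K := (-1) ^ k.

Record is_grading (E : lmodType K) (H : Z -> set E) : Prop := IsGrading {
  grading_submodule : forall a, submodule (H a);
  grading_span : forall x, exists (s : seq Z) (f : Z -> E),
    (forall a, H a (f a)) /\ x = \sum_(a <- s) f a;
  grading_indep : forall (s : seq Z) (f : Z -> E), uniq s ->
    (forall a, H a (f a)) -> \sum_(a <- s) f a = 0 ->
    forall a, a \in s -> f a = 0 }.

Record gradedVect := GradedVect {
  gvect :> lmodType K;
  homog : Z -> set gvect;
  homogP : is_grading homog }.

Record is_gradedLie (L : gradedVect) (br : L -> L -> L) : Prop := IsGradedLie {
  br_linearl : forall z, linear (br^~ z);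
  br_linearr : forall z, linear (br z);
  br_weight : forall a b x y, homog a x -> homog b y -> homog (a + b) (br x y);
  br_antisym : forall a b (x y : L), homog a x -> homog b y ->
    br x y = - (sgn (ip a b) *: br y x);
  br_jacobi : forall a b c (x y z : L),
    homog a x -> homog b y -> homog c z ->
    br x (br y z) = br (br x y) z + sgn (ip a b) *: br y (br x z) }.

(* The letters of the word w are homogeneous of respective degrees d. *)
Definition homword (W : gradedVect) (d : seq Z) (w : seq W) : Prop :=
  size d = size w /\
  forall i, (i < size w)%N -> homog (nth 0 d i) (nth 0 w i).

Section Coderivations.
Variable W : gradedVect.
Local Notation T := (tens_alg W).

Definition tens_homog (a : Z) : set T :=
  linspan [set t | exists d w, [/\ homword d w, \sum_(b <- d) b = a & t = tens w]].

Definition subword (w : seq W) (I : {set 'I_(size w)}) : seq W :=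
  [seq nth 0 w i | i : 'I_(size w) <- enum I].

(* The pairs exchanged when sorting (W_I, W_J), with J the complement of I,
   are the j < i with i in I and j in J. *)
Definition koszul (q : nat) (d : seq Z) (I : {set 'I_q}) : K :=
  \prod_(i in I) \prod_(j in ~: I | (j < i)%N) sgn (ip (nth 0 d i) (nth 0 d j)).

(* Homogeneous words span, so this determines Delta; no sign involves the last
   letter x, which therefore need not be homogeneous. *)
Definition is_coproduct (Delta : T -> tensor T T) : Prop :=
  linear Delta /\
  forall d (w : seq W) (x : W), homword d w ->
    Delta (tens (rcons w x)) =
      \sum_(I : {set 'I_(size w)} | I != finset.set0)
        koszul d I *: tprod (tens (subword I)) (tens (rcons (subword (~: I)) x)).

Definition coproduct : T -> tensor T T := xget 0 is_coproduct.

(* [tmap b f g] is the map f (x) g, for g of weight b. *)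
Definition is_tmap (b : Z) (f g : T -> T) (h : tensor T T -> tensor T T) : Prop :=
  linear h /\
  forall a x y, tens_homog a x ->
    h (tprod x y) = sgn (ip b a) *: tprod (f x) (g y).

Definition tmap (b : Z) (f g : T -> T) : tensor T T -> tensor T T :=
  xget 0 (is_tmap b f g).

Record is_coder (Q : Z) (D : T -> T) : Prop := IsCoder {
  coder_linear : linear D;
  coder_weight : forall a x, tens_homog a x -> tens_homog (a + Q) (D x);
  coder_coproduct : forall x,
    coproduct (D x) = tmap 0 D id (coproduct x) + tmap Q id D (coproduct x) }.

(* Elements of the direct sum of the coderivations of all weights, given by
   their homogeneous components. *)
Definition is_CoDer (D : Z -> T -> T) : Prop :=
  (forall Q, is_coder Q (D Q)) /\ finsupp D.

Definition comm (Q R : Z) (D D' : T -> T) : T -> T :=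
  fun x => D (D' x) - sgn (ip Q R) *: D' (D x).

Definition commutator (D D' : Z -> T -> T) : Z -> T -> T :=
  fun S x => \sum_(Q \in [set: Z]) comm Q (S - Q) (D Q) (D' (S - Q)) x.
End Coderivations.
End Graded.


Section Bracket.
Variables (K : fieldType) (n : nat) (V : gradedVect K n.+1).
Local Notation Z := 'rV[int]_n.+1.

Definition e1 : Z := delta_mx 0 0.

Lemma shift_grading : is_grading (fun a : Z => @homog _ _ V (a + e1)).
Proof.
have [Hsub Hspan Hind] := homogP V; split=> [a|x|s f us Hf sf0 a sa].
- exact: Hsub.
- have [s [f [Hf ->]]] := Hspan x.
  exists [seq a - e1 | a <- s], (fun a => f (a + e1)); split=> //.
  by rewrite big_map; apply: eq_bigr => a _; rewrite subrK.
- have := Hind [seq b + e1 | b <- s] (fun b => f (b - e1)).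
  rewrite map_inj_uniq; last exact: addIr.
  have Hf' b : homog b (f (b - e1)) by have := Hf (b - e1); rewrite subrK.
  move=> /(_ us Hf'); rewrite big_map.
  under eq_bigr do rewrite addrK.
  by move=> /(_ sf0) /(_ (a + e1)); rewrite addrK; apply; exact: map_f.
Qed.

(* Same underlying space as V, so that the suspension maps are the identity on
   vectors and only change degrees. *)
Definition desusp : gradedVect K n.+1 := GradedVect shift_grading.

(* A p-linear map is encoded as a function on words vanishing off length p. *)
Definition Mult (A : Z) (a : nat) : set (seq V -> V) :=
  [set f | [/\ forall w, size w <> a.+1 -> f w = 0,
     forall u v c x y, (size u + size v = a)%N ->
       f (u ++ (c *: x + y) :: v) = c *: f (u ++ x :: v) + f (u ++ y :: v)
   & forall d w, size w = a.+1 -> homword d w ->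
       homog (A + \sum_(b <- d) b) (f w)]].

(* The sequence (pi_p), p >= 1, is indexed by a = p - 1: [pi a] is (a+1)-linear. *)
Definition Cdeg (Q : Z) : set (nat -> seq V -> V) :=
  [set pi | forall a, Mult (Q - e1 *+ a) a (pi a)].

Lemma Mult_submodule A a : submodule (Mult A a).
Proof.
split=> [|k f g [f0 fl fw] [g0 gl gw]]; split.
- by [].
- by move=> u v c x y _; change (0 = c *: (0 : V) + 0); rewrite scaler0 addr0.
- by move=> d w _ _; have [] := grading_submodule (homogP V) (A + \sum_(b <- d) b).
- move=> w sw; change (k *: f w + g w = 0).
  by rewrite f0 // g0 // scaler0 addr0.
- move=> u v c x y uv; pose h w := k *: f w + g w.
  change (h (u ++ (c *: x + y) :: v) = c *: h (u ++ x :: v) + h (u ++ y :: v)).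
  rewrite /h fl // gl // !scalerDr !scalerA [k * c]mulrC -!addrA.
  by congr (_ + _); rewrite addrCA.
- move=> d w sw dw; change (homog (A + \sum_(b <- d) b) (k *: f w + g w)).
  have [_ HD] := grading_submodule (homogP V) (A + \sum_(b <- d) b).
  by apply: HD; [exact: fw | exact: gw].
Qed.

Definition Cpred : set (Z -> nat -> seq V -> V) :=
  [set pi | (forall Q, Cdeg Q (pi Q)) /\ finsupp pi].

Lemma Cpred_submodule : submodule Cpred.
Proof.
have [F0 FD] := finsupp_submodule Z (nat -> seq V -> V : lmodType K).
split=> [|k f g [fC fF] [gC gF]]; split => //.
- by move=> Q a; have [] := Mult_submodule (Q - e1 *+ a) a.
- by move=> Q a; have [_ HD] := Mult_submodule (Q - e1 *+ a) a; apply: HD;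
    [exact: fC | exact: gC].
- exact: FD.
Qed.

Definition Cin : {pred Z -> nat -> seq V -> V} := [pred pi | `[< Cpred pi >]].

HB.instance Definition _ :=
  GRing.isSubmodClosed.Build K (Z -> nat -> seq V -> V) Cin
    (submodule_closed Cpred_submodule).

(* Finitely supported families: the external direct sum of the [Cdeg Q]. *)
Record Ctype := CType { Ccomp :> Z -> nat -> seq V -> V; _ : Ccomp \in Cin }.

HB.instance Definition _ := [isSub for Ccomp].
HB.instance Definition _ := [Choice of Ctype by <:].
HB.instance Definition _ := [SubChoice_isSubLmodule of Ctype by <:].

Definition Chomog (Q : Z) : set Ctype :=
  [set pi | forall R, R != Q -> pi R = 0].

Lemma Csum (s : seq Z) (f : Z -> Ctype) R :
  (\sum_(Q <- s) f Q : Ctype) R = \sum_(Q <- s) (f Q : Z -> _) R.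
Proof.
elim: s => [|Q s IH]; first by rewrite !big_nil.
by rewrite !big_cons -IH.
Qed.

Lemma C_grading : is_grading Chomog.
Proof.
split=> [Q|pi|s f us fH sf0 Q Qs].
- split=> [R //|c x y xH yH R RQ] /=.
  change (c *: Ccomp x R + Ccomp y R = 0).
  by rewrite xH // yH // scaler0 addr0.
- have /asboolP[piC piF] := valP pi.
  have compC Q : (fun R => if R == Q then pi Q else 0) \in Cin.
    apply/asboolP; split=> [R a|].
      case: eqP => [->|_]; first exact: piC.
      by have [] := Mult_submodule (R - e1 *+ a) a.
    apply: sub_finite_set (finite_set1 Q) => R /=.
    by case: eqP.
  have /finite_seqP[s sE] := piF.
  exists (undup s), (fun Q => CType (compC Q)); split=> [Q R /negPf /= -> //|].
  apply/val_inj/funext => R /=; rewrite Csum /=.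
  have [Rs|Rs] := boolP (R \in undup s).
    rewrite (bigD1_seq R) ?undup_uniq //= eqxx big1 ?addr0 // => Q QR.
    by rewrite eq_sym (negPf QR).
  rewrite big1_seq => [|Q /andP[_ Qs]]; last first.
    by case: eqP => // RQ; move: Rs; rewrite RQ Qs.
  apply: contrapT => piR; move/negP: Rs; apply; rewrite mem_undup.
  by have : [set i | Ccomp pi i <> 0] R by []; rewrite sE.
- apply/val_inj/funext => R /=; have [->|RQ] := eqVneq R Q; last exact: fH.
  have := congr1 (fun x : Ctype => x Q) sf0; rewrite Csum (bigD1_seq Q) //=.
  by rewrite big1 ?addr0 // => P PQ; apply: fH; rewrite eq_sym.
Qed.

Definition C : gradedVect K n.+1 := GradedVect C_grading.

Local Notation T := (tens_alg desusp).

(* The sign of the p-fold tensor power of the suspension on a word of degrees d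
   in the desuspension, by (f (x) g)(v1 (x) v2) = (-1)^<g,v1> f(v1) (x) g(v2)
   with f the suspension and g its (p-1)-fold tensor power, of weight (p-1)e1. *)
Fixpoint susp_sgn (d : seq Z) : K :=
  if d is a :: d' then sgn K (ip (e1 *+ size d') a) * susp_sgn d' else 1.

Definition has_corestr (pi : nat -> seq V -> V) (D : T -> T) : Prop :=
  forall a d (w : seq desusp), size w = a.+1 -> homword d w ->
    corestr (D (tens w)) = ((-1) ^+ (a.+1 * a)./2 * susp_sgn d) *: pi a w.

Definition phi_deg (Q : Z) (pi : nat -> seq V -> V) : T -> T :=
  xget 0 [set D | is_coder Q D /\ has_corestr pi D].

Definition phi (pi : C) : Z -> T -> T := fun Q => phi_deg Q (Ccomp pi Q).

Definition phi_inv (D : Z -> T -> T) : C := xget 0 [set pi | phi pi = D].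

Definition bracket (pi rho : C) : C := phi_inv (commutator (phi pi) (phi rho)).

Definition phi_isomorphism : Prop :=
  [/\ linear phi, forall pi, is_CoDer (phi pi)
    & forall D, is_CoDer D -> exists! pi, phi pi = D].

Definition phi_stem (A : Z) (a : nat) (f : seq V -> V) : T -> T :=
  phi_deg (A + e1 *+ a) (fun b => if b == a then f else 0).

Definition phi_stem_inv (A : Z) (a : nat) (D : T -> T) : seq V -> V :=
  xget 0 [set f | Mult A a f /\ phi_stem A a f = D].

Definition stem (A : Z) (a : nat) (B : Z) (b : nat) (f g : seq V -> V) : seq V -> V :=
  sgn K (1 + ip (e1 *+ a) (e1 *+ b + B)) *:
    phi_stem_inv (A + B) (a + b)
      (comm (A + e1 *+ a) (B + e1 *+ b) (phi_stem A a f) (phi_stem B b g)).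

End Bracket.

(* Main.v *)
Require Import Defs.
From HB Require Import structures.
From mathcomp Require Import all_boot all_order all_algebra.
From mathcomp Require Import boolp classical_sets functions.
From mathcomp Require Import cardinality fsbigop zify.
Import GRing.Theory.
Local Open Scope ring_scope.

(** The bracket on C(V) is the graded commutator of coderivations of
    T = T(desusp V) transported along phi, so the whole proposition rests on
    phi being bijective onto the coderivations; the Lie axioms are then the
    ones of graded commutators.

    Everything is computed on words whose letters carry a chosen degree
    (_decorated_ words, lists of pairs degree-letter).  Such words with
    homogeneous letters span T ([homog_word_span]), and any multilinear function
    of decorated words extends to T ([homog_word_lift]).  On decorated words the
    two structural operations are sums obeying a recursion on the first letter:
    - [unshuffle] runs over the terms of the coproduct; the first letter x goes
      to the left factor without sign, or to the right one past the letters I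
      of the left factor, with sign (-1)^<x,I>;
    - [coder_word] runs over the terms of the coderivation with corestriction q;
      the letter x is the last argument of q, or is passed over by Q, or is
      the first argument of q, in which case what remains is the coderivation
      of weight Q + x with corestriction q(x, ...).  This last point is what
      makes the recursion close up: the sign (-1)^<Q+x,I> for jumping over I
      is the product of the sign for Q and of the Koszul sign of x.
    Both sums take the summand as a functional argument, so that compositions
    are nested sums, and an induction on the word proves the coderivation
    identity ([coder_word_unshuffle]).  This gives every multilinear q of
    the right weight a coderivation ([coder_exists]).

    Conversely, let m : T (x) T -> T append the corestriction of the right
    factor to the left factor.  Only the term of the coproduct whose right
    factor is the last letter survives, so y = corestr y + m(Delta y)
    ([reconstruct_exists]); applied to D(w), this determines a coderivation D
    from its corestrictions by induction on the length ([coder_unique]).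

    The formula in terms of stem brackets compares corestrictions: that of
    phi(pi) o phi(rho) at w is [coder_word] with inserted map rho and outer map
    pi, which is bilinear in (pi, rho) and sees only the pairs of components of
    arities a + 1 and b + 1 with a + b + 1 the length of w ([coder_word_size]).
    The sign in the definition of the stem bracket and the sign of the formula
    are the same, hence cancel ([stem_componentE]). *)

Set Implicit Arguments.
Unset Strict Implicit.
Unset Printing Implicit Defensive.

(** * Linear maps, submodules and finitely supported sums *)

Section LinearMaps.
Variables (K : fieldType) (E F : lmodType K) (f : E -> F).
Hypothesis fL : linear f.

Lemma linear_fun0 : f 0 = 0.
Proof.
by have := fL (-1) 0 0; rewrite scaler0 addr0 scaleN1r addNr.
Qed.

Lemma linear_funD x y : f (x + y) = f x + f y.
Proof. by have := fL 1 x y; rewrite !scale1r. Qed.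

Lemma linear_funZ c x : f (c *: x) = c *: f x.
Proof. by have := fL c x 0; rewrite !addr0 linear_fun0 addr0. Qed.

Lemma linear_funB x y : f (x - y) = f x - f y.
Proof. by rewrite addrC -scaleN1r fL scaleN1r [in RHS]addrC. Qed.

Lemma linear_fun_sum I (r : seq I) (P : pred I) (g : I -> E) :
  f (\sum_(i <- r | P i) g i) = \sum_(i <- r | P i) f (g i).
Proof.
elim/big_rec2: _ => [|i y x _ <-]; [exact: linear_fun0 | exact: linear_funD].
Qed.
End LinearMaps.

Lemma linear_comm (K : fieldType) (E : lmodType K) (f g : E -> E) s :
  linear f -> linear g -> linear (fun x => f (g x) - s *: g (f x)).
Proof.
move=> fL gL c x y; rewrite gL fL fL gL !scalerDr !scalerN !scalerA.
by rewrite opprD [c * _]mulrC addrACA.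
Qed.

Section Submodules.
Variables (K : fieldType) (E : lmodType K).

Lemma submoduleD (B : set E) x y : submodule B -> B x -> B y -> B (x + y).
Proof. by move=> [_ BD] Bx By; rewrite -[x]scale1r; apply: BD. Qed.

Lemma submoduleZ (B : set E) c x : submodule B -> B x -> B (c *: x).
Proof. by move=> [B0 BD] Bx; rewrite -[_ *: _]addr0; apply: BD. Qed.

Lemma submodule_sum (B : set E) I (r : seq I) (P : pred I) (g : I -> E) :
  submodule B -> (forall i, P i -> B (g i)) -> B (\sum_(i <- r | P i) g i).
Proof.
move=> BS Bg; elim/big_ind: _ => // [|x y Bx By]; first by case: BS.
exact: submoduleD.
Qed.

Lemma linspan_sub (A B : set E) x :
  submodule B -> (forall a, A a -> B a) -> linspan A x -> B x.
Proof. by move=> BS AB; apply; split. Qed.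

Lemma mem_linspan (A : set E) x : A x -> linspan A x.
Proof. by move=> Ax B [_ AB]; exact: AB. Qed.

(** Linear maps that agree on a spanning set agree everywhere: the
    starting point of the extensionality lemmas below. *)
Lemma submodule_eq (F : lmodType K) (f g : E -> F) :
  linear f -> linear g -> submodule [set x | f x = g x].
Proof.
move=> fL gL; split=> [|c x y /= fx fy] /=; first by rewrite !linear_fun0.
by rewrite fL gL fx fy.
Qed.

Lemma submodule_preimage (F : lmodType K) (f : E -> F) (B : set F) :
  linear f -> submodule B -> submodule [set x | B (f x)].
Proof.
move=> fL [B0 BD]; split=> [|c x y /= fx fy] /=; first by rewrite linear_fun0.
by rewrite fL; apply: BD.
Qed.
End Submodules.

Section FiniteSums.
Variables (K : fieldType) (I : choiceType) (E : lmodType K).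

Lemma fsum_seq (g : I -> E) (s : seq I) :
  uniq s -> (forall i, g i <> 0 -> i \in s) ->
  \sum_(i \in [set: I]) g i = \sum_(i <- s) g i.
Proof.
move=> us gs; rewrite (@fsbigE _ _ _ _ _ s) // => [|i _ /negP nis].
  by apply: eq_bigl => i; apply: mem_set.
by apply: contrapT => /gs.
Qed.

Lemma finsupp_seq (g : I -> E) : finsupp g ->
  exists2 s : seq I, uniq s & forall i, g i <> 0 -> i \in s.
Proof.
move=> /finite_seqP[s gs]; exists (undup s); first exact: undup_uniq.
move=> i gi; rewrite mem_undup.
by have : [set i | g i <> 0]%classic i by []; rewrite gs.
Qed.

Lemma fsum_linear c (g h : I -> E) : finsupp g -> finsupp h ->
  \sum_(i \in [set: I]) (c *: g i + h i) =
    c *: (\sum_(i \in [set: I]) g i) + \sum_(i \in [set: I]) h i.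
Proof.
move=> /finsupp_seq[s us gs] /finsupp_seq[t ut ht].
have ust : uniq (undup (s ++ t)) := undup_uniq _.
rewrite !(fsum_seq ust) => [|i ghi|i hi|i gi].
- by rewrite scaler_sumr -big_split.
- rewrite mem_undup mem_cat; have [gi|/gs-> //] := pselect (g i = 0).
  by rewrite ht ?orbT // => hi; apply: ghi; rewrite gi hi scaler0 addr0.
- by rewrite mem_undup mem_cat ht ?orbT.
by rewrite mem_undup mem_cat gs.
Qed.

Lemma fsum_single (g : I -> E) i :
  (forall j, j <> i -> g j = 0) -> \sum_(j \in [set: I]) g j = g i.
Proof.
move=> gi; rewrite (@fsum_seq _ [:: i]) ?big_seq1 // => j gj.
by rewrite inE; apply/eqP; apply: contrapT => /gi.
Qed.
End FiniteSums.

(** * Universal properties of free modules, quotients and tensors *)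

Section Lifts.
Variable K : fieldType.

Section FreeModule.
Variable X : Type.

Lemma freemod_finsupp (p : freemod K X) : finsupp (p : X -> K).
Proof. by case: p => p /= /asboolP. Qed.

Lemma freemod_span (B : set (freemod K X)) :
  submodule B -> (forall x, B (gen K x)) -> forall p, B p.
Proof.
move=> BS Bg p.
have [s us ps] := @finsupp_seq K {classic X} K^o _ (freemod_finsupp p).
suff -> : p = \sum_(x <- s) (p : X -> K) x *: gen K (x : X).
  by apply: submodule_sum => // i _; apply: submoduleZ.
apply/val_inj/funext => y /=.
have sumE (r : seq {classic X}) (q : {classic X} -> freemod K X) :
    (\sum_(x <- r) q x : freemod K X) y = \sum_(x <- r) (q x : X -> K) y.
  elim: r => [|x r IH]; first by rewrite !big_nil.
  by rewrite !big_cons -IH.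
rewrite sumE.
have genE (x : {classic X}) :
    ((p : X -> K) x *: gen K (x : X) : freemod K X) y =
      if (y : {classic X}) == x then (p : X -> K) x else 0.
  change (p x * (if `[< y = x >] then 1 else 0) =
    if (y : {classic X}) == x then p x else 0).
  by case: asboolP => [yx|yx]; case: eqP => // _; rewrite ?mulr1 ?mulr0.
under eq_bigr do rewrite genE.
have [ys|ys] := boolP ((y : {classic X}) \in s).
  rewrite (bigD1_seq (y : {classic X})) //= eqxx big1 ?addr0 // => x /negPf xy.
  by rewrite eq_sym xy.
rewrite big1_seq => [|x /andP[_ xs]].
  by apply: contrapT => /ps; apply/negP.
by case: eqP xs => // <-; rewrite (negPf ys).
Qed.

(** The index type is an arbitrary type, hence the detour through
    [{classic X}], which has the choice structure that finite sums require. *)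
Lemma freemod_lift (E : lmodType K) (f : X -> E) :
  exists2 F : freemod K X -> E, linear F & forall x, F (gen K x) = f x.
Proof.
have fF (p : freemod K X) : finsupp (fun x => p x *: f x).
  apply: sub_finite_set (freemod_finsupp p) => x /= pf px; apply: pf.
  by rewrite px scale0r.
exists (fun p => \sum_(x \in [set: {classic X}]) (p : X -> K) x *: f x).
  move=> c p q; rewrite -fsum_linear; [|exact: fF|exact: fF].
  apply: eq_fsbigr => x _; rewrite scalerA -scalerDl; congr (_ *: _).
move=> x; rewrite (@fsum_single _ _ _ _ (x : {classic X})) /=.
  by case: asboolP => //; rewrite scale1r.
by move=> y yx; case: asboolP => //; rewrite scale0r.
Qed.
End FreeModule.

Section Quotient.
Variables (E : lmodType K) (A : set E).

Lemma modquot_pi_linear : linear (modquot_pi A).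
Proof. by move=> c x y; rewrite modquot_piD modquot_piZ. Qed.

Lemma modquot_pi_rel x : A x -> modquot_pi A x = 0.
Proof.
move=> Ax; rewrite -(linear_fun0 modquot_pi_linear); apply/modquot_piP.
by rewrite subr0; apply: mem_linspan.
Qed.

Lemma modquot_surj (y : modquot A) : exists x, y = modquot_pi A x.
Proof.
by exists (repr (y : {ideal_quot in_linspan A})); rewrite modquot_piK.
Qed.

Lemma modquot_lift (F : lmodType K) (f : E -> F) :
  linear f -> (forall x, A x -> f x = 0) ->
  exists2 g : modquot A -> F, linear g & forall x, g (modquot_pi A x) = f x.
Proof.
move=> fL fA.
pose g (y : modquot A) := f (repr (y : {ideal_quot in_linspan A})).
have gE x : g (modquot_pi A x) = f x.
  apply/eqP; rewrite /g -subr_eq0 -linear_funB //; apply/eqP.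
  have : linspan A (repr (modquot_pi A x : {ideal_quot in_linspan A}) - x).
    by apply/modquot_piP; rewrite modquot_piK.
  apply: linspan_sub fA; apply: (submodule_eq fL) => c y z.
  by rewrite scaler0 addr0.
exists g => // c x y; have [x' ->] := modquot_surj x.
by have [y' ->] := modquot_surj y; rewrite -modquot_pi_linear !gE fL.
Qed.
End Quotient.

Section TensorProduct.
Variables A B : lmodType K.

Lemma tprod_linearl (y : B) : linear (fun x : A => tprod x y).
Proof.
move=> c x z; rewrite -[RHS](modquot_pi_linear _ c).
by apply/modquot_piP; apply: mem_linspan; left; exists c, x, z, y.
Qed.

Lemma tprod_linearr (x : A) : linear (fun y : B => tprod x y).
Proof.
move=> c y z; rewrite -[RHS](modquot_pi_linear _ c).
by apply/modquot_piP; apply: mem_linspan; right; exists c, y, z, x.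
Qed.

Lemma tensor_span (P : set (tensor A B)) :
  submodule P -> (forall x y, P (tprod x y)) -> forall t, P t.
Proof.
move=> PS Pxy t; have [p ->] := modquot_surj t.
have := submodule_preimage (@modquot_pi_linear _ (@bilinear_rel K A B)) PS.
by move=> /freemod_span; apply=> -[x y]; apply: Pxy.
Qed.

Lemma tensor_lift (E : lmodType K) (f : A -> B -> E) :
  (forall y, linear (f^~ y)) -> (forall x, linear (f x)) ->
  exists2 F : tensor A B -> E, linear F & forall x y, F (tprod x y) = f x y.
Proof.
move=> fl fr; have [F FL Fg] := freemod_lift (fun p => f p.1 p.2).
have [p|G GL Gp] := modquot_lift (A := @bilinear_rel K A B) FL; last first.
  by exists G => // x y; rewrite Gp Fg.
case=> -[c [x [y [z ->]]]]; rewrite linear_funB // FL !Fg /=.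
  by rewrite fl subrr.
by rewrite fr subrr.
Qed.
End TensorProduct.

Section TensorAlgebra.
Variable W : lmodType K.
Local Notation T := (tens_alg W).

Definition multilinear (E : lmodType K) (f : seq W -> E) : Prop :=
  forall u v c x y,
    f (u ++ (c *: x + y) :: v) = c *: f (u ++ x :: v) + f (u ++ y :: v).

Lemma tens_nil : tens [::] = 0 :> T.
Proof. by apply: modquot_pi_rel; left. Qed.

Lemma tens_multilinear : multilinear (@tens K W).
Proof.
move=> u v c x y; rewrite -[RHS](modquot_pi_linear _ c).
by apply/modquot_piP; apply: mem_linspan; right; exists u, v, c, x, y.
Qed.

Lemma tens_span (P : set T) :
  submodule P -> (forall w, P (tens w)) -> forall t, P t.
Proof.
move=> PS Pw t; have [p ->] := modquot_surj t.
have := submodule_preimage (@modquot_pi_linear _ (@multilinear_rel K W)) PS.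
by move=> /freemod_span; apply.
Qed.

Lemma tens_lift (E : lmodType K) (f : seq W -> E) :
  f [::] = 0 -> multilinear f ->
  exists2 F : T -> E, linear F & forall w, F (tens w) = f w.
Proof.
move=> f0 fM; have [F FL Fg] := freemod_lift f.
have [p|G GL Gp] := modquot_lift (A := @multilinear_rel K W) FL; last first.
  by exists G => // w; rewrite Gp Fg.
case=> [->|[u [v [c [x [y ->]]]]]]; first by rewrite Fg.
by rewrite linear_funB // FL !Fg fM subrr.
Qed.

Lemma corestrP : is_corestr (@corestr K W).
Proof.
apply: (@xgetPex (T -> W : choiceType)).
pose f (w : seq W) : W := if w is [:: x] then x else 0.
have [//|u v c x y|p pL pE] := @tens_lift W f.
  by case: u => [|z u]; case: v => [|z' v] //=; rewrite ?scaler0 ?addr0 //;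
    case: u => [|z2 u] //=; rewrite ?scaler0 ?addr0.
exists p; split=> // w sw.
by rewrite pE /f; case: w sw => [|x [|y v]].
Qed.

Lemma corestr_linear : linear (@corestr K W).
Proof. by case: corestrP. Qed.

Lemma corestr1 (x : W) : corestr (tens [:: x]) = x.
Proof. by case: corestrP => _ ->. Qed.

Lemma corestr_size (w : seq W) : size w != 1%N -> corestr (tens w) = 0.
Proof. by case: corestrP => _ _; apply. Qed.
End TensorAlgebra.
End Lifts.

(** * Signs *)

Section Signs.
Variables (K : fieldType) (m : nat).
Local Notation Z := 'rV[int]_m.

Lemma ipDl (a b c : Z) : ip (a + b) c = ip a c + ip b c.
Proof. by rewrite -big_split; apply: eq_bigr => i _; rewrite mxE mulrDl. Qed.

Lemma ipC (a b : Z) : ip a b = ip b a.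
Proof. by apply: eq_bigr => i _; rewrite mulrC. Qed.

Lemma ipDr (a b c : Z) : ip a (b + c) = ip a b + ip a c.
Proof. by rewrite ![ip a _]ipC ipDl. Qed.

Lemma sgnD (i j : int) : sgn K (i + j) = sgn K i * sgn K j.
Proof. by rewrite /sgn expfzDr // oppr_eq0 oner_eq0. Qed.

Lemma sgn_sqr (i : int) : sgn K i * sgn K i = 1.
Proof. by rewrite /sgn -expfzMl mulrNN mulr1 exp1rz. Qed.

Definition sg (a b : Z) : K := sgn K (ip a b).

Lemma sgDl a b c : sg (a + b) c = sg a c * sg b c.
Proof. by rewrite /sg ipDl sgnD. Qed.

Lemma sgDr a b c : sg a (b + c) = sg a b * sg a c.
Proof. by rewrite /sg ipDr sgnD. Qed.

Lemma sgC a b : sg a b = sg b a.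
Proof. by rewrite /sg ipC. Qed.

Lemma sg_sqr a b : sg a b * sg a b = 1.
Proof. exact: sgn_sqr. Qed.

Lemma sg0l a : sg 0 a = 1.
Proof. by rewrite /sg /ip big1 // => i _; rewrite mxE mul0r. Qed.

Lemma sg0r a : sg a 0 = 1.
Proof. by rewrite sgC sg0l. Qed.
End Signs.

(** * Decorated words and extension from homogeneous letters *)

Section DecoratedWords.
Variables (K : fieldType) (m : nat) (W : gradedVect K m).
Local Notation Z := 'rV[int]_m.
Local Notation L := (Z * W)%type.
Local Notation sg := (@sg K m).

Definition letters (h : seq L) : seq W := map snd h.
Definition deg (h : seq L) : Z := \sum_(l <- h) l.1.

Fixpoint homog_word (h : seq L) : Prop :=
  if h is l :: h' then homog l.1 l.2 /\ homog_word h' else True.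

Lemma deg_nil : deg [::] = 0.
Proof. by rewrite /deg big_nil. Qed.

Lemma deg_cons l h : deg (l :: h) = l.1 + deg h.
Proof. by rewrite /deg big_cons. Qed.

Lemma homog_word_cat g h : homog_word (g ++ h) <-> homog_word g /\ homog_word h.
Proof. by elim: g => [|l g IH] /=; tauto. Qed.

Lemma homwordP d (w : seq W) : homword d w <->
  exists h, [/\ homog_word h, d = map fst h & w = letters h].
Proof.
split=> [[sdw dw]|[h [hh -> ->]]].
  elim: d w sdw dw => [|a d IH] [|x w] //= sdw dw; first by exists [::].
  have [||h [hh -> ->]] := IH w; first by case: sdw.
    by move=> i iw; apply: (dw i.+1).
  by exists ((a, x) :: h); split=> //=; split=> //; apply: (dw 0%N).
split; first by rewrite !size_map.
elim: h hh => [|l h IH] //= [hl hh] [|i] //= iw; exact: IH.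
Qed.

(** Linear in each letter, the degree attached to it being kept fixed.  Letters
    need not be homogeneous, nor the attached degree be theirs: signs are read
    off the attached degrees only, so no side condition arises. *)
Definition dmultilinear (E : lmodType K) (f : seq L -> E) : Prop :=
  forall u v a c x y, f (u ++ (a, c *: x + y) :: v) =
    c *: f (u ++ (a, x) :: v) + f (u ++ (a, y) :: v).

Definition dbimultilinear (E : lmodType K) (G : seq L -> seq L -> E) : Prop :=
  (forall J, dmultilinear (G^~ J)) /\ (forall I, dmultilinear (G I)).

Lemma dmultilinear_cons (E : lmodType K) (f : seq L -> E) l :
  dmultilinear f -> dmultilinear (fun v => f (l :: v)).
Proof. by move=> fM u v a c x y; apply: (fM (l :: u)). Qed.

Lemma dmultilinear0 (E : lmodType K) (f : seq L -> E) u v a :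
  dmultilinear f -> f (u ++ (a, 0) :: v) = 0.
Proof.
move=> /(_ u v a (-1) 0 0).
by rewrite scaler0 addr0 scaleN1r addNr.
Qed.

Lemma dmultilinear_comp (E F : lmodType K) (f : seq L -> E) (g : E -> F) :
  linear g -> dmultilinear f -> dmultilinear (fun v => g (f v)).
Proof. by move=> gL fM u v a c x y; rewrite fM gL. Qed.

Lemma dmultilinear_letters (E : lmodType K) (f : seq W -> E) :
  multilinear f -> dmultilinear (fun h => f (letters h)).
Proof. by move=> fM u v a c x y; rewrite /letters !map_cat /= fM. Qed.

Lemma dmultilinear_degs (E : lmodType K) (f : seq L -> E) (s : seq Z -> K) :
  dmultilinear f -> dmultilinear (fun h => s (map fst h) *: f h).
Proof.
move=> fM u v a c x y; rewrite !map_cat /= fM scalerDr !scalerA.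
by rewrite [c * _]mulrC.
Qed.

Lemma dmultilinear_sg (E : lmodType K) (f : seq L -> E) a :
  dmultilinear f -> dmultilinear (fun h => sg a (deg h) *: f h).
Proof.
move=> fM; have := dmultilinear_degs (fun d => sg a (\sum_(b <- d) b)) fM.
by congr dmultilinear; apply/funext => h; rewrite big_map.
Qed.

Lemma homog0 a : homog (g := W) a 0.
Proof. by have [] := grading_submodule (homogP W) a. Qed.

Lemma homogZ a c (x : W) : homog a x -> homog a (c *: x).
Proof. by apply: submoduleZ; exact: grading_submodule (homogP W) a. Qed.

Section Components.

(** The components of x are characterised rather than constructed: the grading
    provides some decomposition, and its independence makes it unique. *)
Definition decomposes (x : W) (f : Z -> W) : Prop :=
  [/\ forall a, homog a (f a), finsupp f & x = \sum_(a \in [set: Z]) f a].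

Lemma decomposes_exists x : exists f, decomposes x f.
Proof.
have [s [f [fH ->]]] := grading_span (homogP W) x.
have fs a : f a *+ count_mem a s <> 0 -> a \in undup s.
  move=> fa; rewrite mem_undup -has_pred1 has_count lt0n; apply/eqP => s0.
  by apply: fa; rewrite s0.
exists (fun a => f a *+ count_mem a s); split.
- move=> a; rewrite -scaler_nat; apply: submoduleZ (fH a).
  exact: grading_submodule (homogP W) a.
- apply: sub_finite_set (finite_seq (undup s)) => a /=; exact: fs.
- rewrite (fsum_seq (undup_uniq s) fs) -big_undup_iterop_count.
  by apply: eq_bigr => a _; case: (count_mem a s).
Qed.

Lemma decomposes_unique x f g : decomposes x f -> decomposes x g -> f = g.
Proof.
move=> [fH fF ->] [gH gF]; have [s us sf] := finsupp_seq fF.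
have [t ut tg] := finsupp_seq gF; pose r := undup (s ++ t).
have rf a : f a <> 0 -> a \in r by rewrite mem_undup mem_cat => /sf ->.
have rg a : g a <> 0 -> a \in r.
  by rewrite mem_undup mem_cat => /tg ->; rewrite orbT.
rewrite (fsum_seq (undup_uniq _) rf) (fsum_seq (undup_uniq _) rg) => fg.
have fgH a : homog a (f a - g a).
  have Ha := grading_submodule (homogP W) a.
  by rewrite -scaleN1r; apply: submoduleD => //; apply: submoduleZ.
apply/funext => a; have [ar|/negP ar] := boolP (a \in r).
  apply/eqP; rewrite -subr_eq0; apply/eqP.
  apply: (grading_indep (homogP W) (undup_uniq _) fgH) ar.
  by rewrite sumrB fg subrr.
rewrite (contrapT (fun h => ar (rf a h))).
by rewrite (contrapT (fun h => ar (rg a h))).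
Qed.

Definition component (a : Z) (x : W) : W :=
  xget (0 : Z -> W) (decomposes x) a.

Lemma componentP x : decomposes x (component^~ x).
Proof. by have := xgetPex (0 : Z -> W) (decomposes_exists x). Qed.

Lemma component_linear a : linear (component a).
Proof.
move=> c x y; have [xH xF xE] := componentP x; have [yH yF yE] := componentP y.
suff : decomposes (c *: x + y) (fun b => c *: component b x + component b y).
  by move=> /(decomposes_unique (componentP _))/(congr1 (@^~ a)).
split=> [b||]; last by rewrite fsum_linear // -xE -yE.
  by have [_] := grading_submodule (homogP W) b; apply.
have [_ FD] := finsupp_submodule Z W; exact: FD.
Qed.

Lemma component_homog a x : homog a x ->
  forall b, component b x = if b == a then x else 0.
Proof.
move=> xa b; suff : decomposes x (fun b => if b == a then x else 0).
  by move=> /(decomposes_unique (componentP _))/(congr1 (@^~ b)).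
split=> [c||].
- by case: eqP => [->//|_]; case: (grading_submodule (homogP W) c).
- by apply: sub_finite_set (finite_set1 a) => c /=; case: eqP.
- by rewrite (@fsum_single _ _ _ _ a) ?eqxx // => c /eqP/negPf ->.
Qed.
End Components.

Section HomogeneousLift.
Variable E : lmodType K.

(** The value at an arbitrary word of the multilinear extension of f: every
    letter is split into its homogeneous components. *)
Fixpoint expand (f : seq L -> E) (w : seq W) : E :=
  if w is x :: w' then
    \sum_(a \in [set: Z]) expand (fun h => f ((a, component a x) :: h)) w'
  else f [::].

Lemma expand0 w : expand (fun=> 0) w = 0.
Proof. by elim: w => //= x w IH; rewrite fsbig1. Qed.

Lemma expand_finsupp f x w : dmultilinear f ->
  finsupp (fun a => expand (fun h => f ((a, component a x) :: h)) w).
Proof.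
move=> fM; have [_ xF _] := componentP x; apply: sub_finite_set xF => a /= fa xa.
apply: fa; under [X in expand X]funext do rewrite xa (dmultilinear0 [::] _ _ fM).
exact: expand0.
Qed.

Lemma expand_linear c f g w : dmultilinear f -> dmultilinear g ->
  expand (fun h => c *: f h + g h) w = c *: expand f w + expand g w.
Proof.
elim: w f g => //= x w IH f g fM gM; rewrite -fsum_linear.
- by apply: eq_fsbigr => a _; apply: IH; apply: dmultilinear_cons.
- exact: expand_finsupp.
- exact: expand_finsupp.
Qed.

Lemma expand_multilinear f : dmultilinear f -> multilinear (expand f).
Proof.
move=> fM u v c x y; elim: u f fM => [|z u IH] f fM /=; last first.
  rewrite -fsum_linear; [|exact: (expand_finsupp _ (_ ++ _ :: _))..].
  by apply: eq_fsbigr => a _; apply: IH; apply: dmultilinear_cons.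
rewrite -fsum_linear; [|exact: expand_finsupp..].
apply: eq_fsbigr => a _; rewrite -expand_linear; [|exact: dmultilinear_cons..].
congr expand; apply/funext => h; rewrite component_linear.
exact: (fM [::]).
Qed.

Lemma expand_homog_word f h : dmultilinear f -> homog_word h ->
  expand f (letters h) = f h.
Proof.
elim: h f => [|[a x] h IH] f fM //= [xa hh].
rewrite (@fsum_single _ _ _ _ a) => [|b /eqP/negPf ba].
  by rewrite (component_homog xa) eqxx IH //; apply: dmultilinear_cons.
under [X in expand X]funext do
  rewrite (component_homog xa) ba (dmultilinear0 [::] _ _ fM).
exact: expand0.
Qed.

(** Formulas whose signs depend on the degrees of the letters thus define
    linear maps on all of T. *)
Lemma homog_word_lift (f : seq L -> E) : f [::] = 0 -> dmultilinear f ->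
  exists2 F : tens_alg W -> E, linear F &
    forall h, homog_word h -> F (tens (letters h)) = f h.
Proof.
move=> f0 fM; have [//||F FL FE] := @tens_lift _ _ _ (expand f).
  exact: expand_multilinear.
by exists F => // h hh; rewrite FE expand_homog_word.
Qed.
End HomogeneousLift.

Lemma homog_word_span (P : set (tens_alg W)) : submodule P ->
  (forall h, homog_word h -> P (tens (letters h))) -> forall t, P t.
Proof.
move=> PS Ph; apply: (tens_span PS) => w.
suff H : forall u, homog_word u -> P (tens (letters u ++ w)) by exact: (H [::]).
elim: w => [|x w IH] u hu; first by rewrite cats0; apply: Ph.
have [xH xF xE] := componentP x; have [s us sx] := finsupp_seq xF.
pose f y := tens (letters u ++ y :: w); have fL : linear f.
  by move=> c y z; apply: tens_multilinear.
rewrite -/(f x) xE (fsum_seq us sx) linear_fun_sum //.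
apply: submodule_sum => // a _; rewrite /f -cat_rcons.
rewrite -[a in component a x]/(a, component a x).1.
rewrite -[component _ _]/(a, component a x).2 -map_rcons; apply: IH.
by rewrite -cats1; apply/homog_word_cat.
Qed.

Lemma homog_word_ext (E : lmodType K) (f g : tens_alg W -> E) :
  linear f -> linear g ->
  (forall h, homog_word h -> f (tens (letters h)) = g (tens (letters h))) -> f =1 g.
Proof. by move=> fL gL fg; apply: (homog_word_span (submodule_eq fL gL)). Qed.
End DecoratedWords.

(** * The coproduct as a recursive sum over unshuffles *)

Section Unshuffle.
Variables (K : fieldType) (m : nat) (W : gradedVect K m).
Local Notation Z := 'rV[int]_m.
Local Notation L := (Z * W)%type.
Local Notation sg := (@sg K m).

(** Sum over the terms of the coproduct of w.  The last letter always belongs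
    to the right factor, hence the separate term for a word of one letter.
    The summand G is an argument so that iterated operations are nested sums. *)
Fixpoint unshuffle (E : lmodType K) (w : seq L) (G : seq L -> seq L -> E) : E :=
  if w is x :: w' then
    (if nilp w' then G [::] [:: x] else 0)
    + (unshuffle w' (fun I J => G (x :: I) J)
       + unshuffle w' (fun I J => sg x.1 (deg I) *: G I (x :: J)))
  else 0.

(** What all pairs of words occurring in [unshuffle w] have in common. *)
Definition unshuffle_split (w I J : seq L) : Prop :=
  [/\ (size I + size J)%N = size w, J <> [::], deg I + deg J = deg w
    & homog_word w -> homog_word I /\ homog_word J].

Section Sums.
Variable E : lmodType K.

Lemma unshuffle_ext w (G H : seq L -> seq L -> E) :
  (forall I J, unshuffle_split w I J -> G I J = H I J) ->
  unshuffle w G = unshuffle w H.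
Proof.
elim: w G H => [|x w IH] G H //= GH; congr (_ + (_ + _)).
- case: nilP => // w0; apply: GH; rewrite w0.
  by split=> //=; rewrite ?deg_nil ?add0r // => -[].
- apply: IH => I J [sIJ J0 dIJ hIJ]; apply: GH; split=> //=.
  + by rewrite addSn sIJ.
  + by rewrite !deg_cons -addrA dIJ.
  + by move=> [xh /hIJ[]].
- apply: IH => I J [sIJ J0 dIJ hIJ]; congr (_ *: _); apply: GH; split=> //=.
  + by rewrite addnS sIJ.
  + by rewrite !deg_cons addrCA dIJ.
  + by move=> [xh /hIJ[]].
Qed.

Lemma unshuffle_linear w c (G H : seq L -> seq L -> E) :
  unshuffle w (fun I J => c *: G I J + H I J) = c *: unshuffle w G + unshuffle w H.
Proof.
elim: w G H => [|x w IH] G H /=; first by rewrite scaler0 addr0.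
under [X in _ + (_ + X) = _]unshuffle_ext => I J _ do
  rewrite scalerDr scalerA mulrC -scalerA.
rewrite !IH !scalerDr; case: nilP => _; rewrite ?scaler0 ?add0r.
  by rewrite [RHS]addrACA; congr (_ + _); rewrite addrACA.
by rewrite addrACA.
Qed.

Lemma unshuffleZ w c (G : seq L -> seq L -> E) :
  unshuffle w (fun I J => c *: G I J) = c *: unshuffle w G.
Proof.
elim: w c G => [|x w IH] c G /=; first by rewrite scaler0.
under [X in _ + (_ + X) = _]unshuffle_ext => I J _ do rewrite scalerA mulrC -scalerA.
by rewrite !IH !scalerDr; case: nilP; rewrite ?scaler0.
Qed.

Lemma unshuffleD w (G H : seq L -> seq L -> E) :
  unshuffle w (fun I J => G I J + H I J) = unshuffle w G + unshuffle w H.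
Proof.
rewrite -[unshuffle w G]scale1r -unshuffle_linear; congr unshuffle.
by apply/funext => I; apply/funext => J; rewrite scale1r.
Qed.

Lemma unshuffle_dmultilinear (G : seq L -> seq L -> E) :
  dbimultilinear G -> dmultilinear (fun w => unshuffle w G).
Proof.
move=> GM u v a c x y; elim: u G GM => [|z u IH] G [GI GJ] /=.
  under [X in _ + (X + _) = _]unshuffle_ext => I J _ do rewrite (GI J [::]).
  under [X in _ + (_ + X) = _]unshuffle_ext => I J _ do
    rewrite (GJ I [::]) scalerDr scalerA mulrC -scalerA.
  rewrite !unshuffle_linear !scalerDr.
  case: nilP => _; rewrite ?scaler0 ?add0r ?(GJ _ [::]).
    by rewrite [RHS]addrACA; congr (_ + _); rewrite addrACA.
  by rewrite addrACA.
(* The separate term for words of one letter is absent from here on. *)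
have nilpF (t : L) : nilp (u ++ t :: v) = false by case: u {IH}.
rewrite !nilpF !add0r !IH; first by rewrite scalerDr addrACA.
  split=> [J|I]; first exact: dmultilinear_sg.
  move=> ? ? ? ? ? ?.
  by rewrite (dmultilinear_cons _ (GJ I)) scalerDr !scalerA mulrC.
split=> [J|I]; last exact: GJ.
by move=> u0 v0 a0 c0 x0 y0; apply: (GI J (z :: u0)).
Qed.
End Sums.

Lemma unshuffle_map (E F : lmodType K) (f : E -> F) w G : linear f ->
  f (unshuffle w G) = unshuffle w (fun I J => f (G I J)).
Proof.
move=> fL; elim: w G => [|x w IH] G /=; first exact: linear_fun0.
rewrite !(linear_funD fL) !IH; congr (_ + (_ + _)).
  by case: ifP => // _; exact: linear_fun0.
by apply: unshuffle_ext => I J _; rewrite linear_funZ.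
Qed.
End Unshuffle.

(** * The coderivation with given corestriction as a recursive sum *)

Section Insertion.
Variables (K : fieldType) (m : nat) (W : gradedVect K m).
Local Notation Z := 'rV[int]_m.
Local Notation L := (Z * W)%type.
Local Notation sg := (@sg K m).

(** Sum over the terms of the coderivation of weight Q and corestriction q at
    the word w.  In the last summand x has become the first argument of q;
    the weight Q + x accounts both for Q and for the Koszul sign of moving x
    to the right. *)
Fixpoint coder_word (E : lmodType K) (Q : Z) (q : seq L -> W) (w : seq L)
    (F : seq L -> E) : E :=
  if w is x :: w' then
    F ((Q + x.1, q [:: x]) :: w')
    + (sg Q x.1 *: coder_word Q q w' (fun v => F (x :: v))
       + coder_word (Q + x.1) (fun v => q (x :: v)) w' F)
  else 0.

Section Sums.
Variable E : lmodType K.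

Lemma eq_coder_word Q q w (F G : seq L -> E) :
  F =1 G -> coder_word Q q w F = coder_word Q q w G.
Proof. by move=> /funext ->. Qed.

(** [coder_word] only evaluates F at nonempty words, no longer than w, of degree
    Q + deg w, and with homogeneous letters if those of w are and q has weight
    Q. *)
Lemma coder_word_ext Q (q : seq L -> W) w (F G : seq L -> E) :
  (forall v, v <> [::] -> (size v <= size w)%N -> deg v = Q + deg w ->
    ((forall u, homog_word u -> homog (Q + deg u) (q u)) ->
      homog_word w -> homog_word v) ->
    F v = G v) ->
  coder_word Q q w F = coder_word Q q w G.
Proof.
elim: w Q q F G => [|x w IH] Q q F G FG //=; congr (_ + (_ *: _ + _)).
- apply: FG => //=; first by rewrite !deg_cons addrA.
  move=> qH [xh wh]; split=> //; have := qH [:: x] (conj xh Logic.I).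
  by rewrite deg_cons deg_nil addr0.
- apply: IH => v v0 sv dv hv; apply: FG => //=.
    by rewrite !deg_cons dv addrCA.
  by move=> qH [xh wh]; split=> //; apply: hv.
- apply: IH => v v0 sv dv hv; apply: FG => //=; first exact: leqW.
    by rewrite deg_cons addrA.
  move=> qH [xh wh]; apply: hv => // u uh.
  by rewrite -addrA -deg_cons; apply: qH.
Qed.

Lemma coder_word0 Q q w : coder_word Q q w (fun=> 0 : E) = 0.
Proof. by elim: w Q q => //= x w IH Q q; rewrite !IH scaler0 !addr0. Qed.

Lemma coder_word_linear Q q w c (F G : seq L -> E) :
  coder_word Q q w (fun v => c *: F v + G v) =
    c *: coder_word Q q w F + coder_word Q q w G.
Proof.
elim: w Q q F G => [|x w IH] Q q F G /=; first by rewrite scaler0 addr0.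
rewrite !IH !scalerDr !scalerA [c * _]mulrC [RHS]addrACA; congr (_ + _).
exact: addrACA.
Qed.

Lemma coder_wordD Q q w (F G : seq L -> E) :
  coder_word Q q w (fun v => F v + G v) = coder_word Q q w F + coder_word Q q w G.
Proof.
rewrite -[coder_word Q q w F]scale1r -coder_word_linear.
by apply: eq_coder_word => v; rewrite scale1r.
Qed.

Lemma coder_wordZ Q q w c (F : seq L -> E) :
  coder_word Q q w (fun v => c *: F v) = c *: coder_word Q q w F.
Proof.
rewrite -[RHS]addr0 -[X in _ + X](coder_word0 Q q w) -coder_word_linear.
by apply: eq_coder_word => v; rewrite addr0.
Qed.

Lemma coder_word_linear_corestr Q c (q r : seq L -> W) w (F : seq L -> E) :
  dmultilinear F ->
  coder_word Q (fun v => c *: q v + r v) w F =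
    c *: coder_word Q q w F + coder_word Q r w F.
Proof.
elim: w Q q r F => [|x w IH] Q q r F FM /=; first by rewrite scaler0 addr0.
rewrite !IH //; last exact: dmultilinear_cons.
rewrite (FM [::]) !scalerDr !scalerA [c * _]mulrC [RHS]addrACA; congr (_ + _).
exact: addrACA.
Qed.

Lemma coder_word_dmultilinear Q (q : seq L -> W) (F : seq L -> E) :
  dmultilinear q -> dmultilinear F -> dmultilinear (fun w => coder_word Q q w F).
Proof.
move=> qM FM u v a c x y; elim: u Q q F qM FM => [|z u IH] Q q F qM FM /=.
  under [X in _ + (_ *: X + _) = _]eq_coder_word => t do rewrite (FM [::]).
  have -> : (fun t => q ((a, c *: x + y) :: t)) =
      (fun t => c *: q ((a, x) :: t) + q ((a, y) :: t)).
    by apply/funext => t; rewrite (qM [::]).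
  rewrite coder_word_linear_corestr // coder_word_linear (qM [::]) (FM [::]).
  rewrite !scalerDr !scalerA [c * _]mulrC [RHS]addrACA; congr (_ + _).
  exact: addrACA.
rewrite (FM (_ :: u)) !IH //; [|exact: dmultilinear_cons..].
rewrite !scalerDr !scalerA [c * _]mulrC [RHS]addrACA; congr (_ + _).
exact: addrACA.
Qed.
End Sums.

Lemma coder_word_map (E F : lmodType K) (f : E -> F) Q q w G : linear f ->
  f (coder_word Q q w G) = coder_word Q q w (fun v => f (G v)).
Proof.
move=> fL; elim: w Q q G => [|x w IH] Q q G /=; first exact: linear_fun0.
by rewrite !(linear_funD fL) (linear_funZ fL) !IH.
Qed.

(** Corestriction retains the words of one letter, and there is exactly one such
    term: the one in which q takes all letters of w. *)
Lemma coder_word_single Q (q : seq L -> W) w (F : seq L -> W) :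
  (forall l, F [:: l] = l.2) -> (forall v, (1 < size v)%N -> F v = 0) ->
  w <> [::] -> coder_word Q q w F = q w.
Proof.
move=> F1 F2; elim: w Q q => // x w IH Q q _ /=.
have [->|/eqP w0] := eqVneq w [::]; first by rewrite F1 scaler0 !addr0.
rewrite IH // F2; last by case: w w0 {IH}.
rewrite (@coder_word_ext _ _ _ _ _ (fun=> 0)) ?coder_word0 ?scaler0 ?add0r //.
by move=> [|y v] // _ _ _ _; apply: F2.
Qed.

(** The coderivation identity.  Expanding both sides by the recursion on the
    first letter x yields the same nine families of terms: x may be
    the last argument of q (a1, a2, and p when nothing else is left), be passed
    over (b1 to b4), or be the first of several arguments of q (c1, c2); each
    family fixes the factors to which x and the value of q go. *)
Lemma coder_word_unshuffle (E : lmodType K) Q q w (G : seq L -> seq L -> E) :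
  coder_word Q q w (fun v => unshuffle v G) =
    unshuffle w (fun I J => coder_word Q q I (G^~ J))
    + unshuffle w (fun I J => sg Q (deg I) *: coder_word Q q J (G I)).
Proof.
elim: w Q q G => [|x w IH] Q q G; first by rewrite addr0.
set s := sg Q x.1.
pose a1 := unshuffle w (fun I J => G ((Q + x.1, q [:: x]) :: I) J).
pose a2 := unshuffle w (fun I J =>
  sg (Q + x.1) (deg I) *: G I ((Q + x.1, q [:: x]) :: J)).
pose b1 := unshuffle w (fun I J => coder_word Q q I (fun A => G (x :: A) J)).
pose b2 := unshuffle w (fun I J => sg Q (deg I) *: coder_word Q q J (G (x :: I))).
pose b3 := unshuffle w (fun I J =>
  sg x.1 (deg I) *: coder_word Q q I (fun A => G A (x :: J))).
pose b4 := unshuffle w (fun I J => (sg Q (deg I) * sg x.1 (deg I)) *: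
  coder_word Q q J (fun B => G I (x :: B))).
pose qx v := q (x :: v).
pose c1 := unshuffle w (fun I J => coder_word (Q + x.1) qx I (G^~ J)).
pose c2 := unshuffle w (fun I J =>
  sg (Q + x.1) (deg I) *: coder_word (Q + x.1) qx J (G I)).
pose p := if nilp w then G [::] [:: (Q + x.1, q [:: x])] else 0.
have -> : coder_word Q q (x :: w) (fun v => unshuffle v G) =
    (p + (a1 + a2)) + (s *: ((b1 + b2) + (s *: b3 + b4)) + (c1 + c2)).
  rewrite /= !IH; congr (_ + (_ *: _ + _)).
  rewrite (@coder_word_ext _ _ _ _ _ (fun v => unshuffle v (fun I J => G (x :: I) J) +
    unshuffle v (fun I J => sg x.1 (deg I) *: G I (x :: J)))); last first.
    by move=> v v0 _ _ _; case: nilP => // _; rewrite add0r.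
  rewrite coder_wordD !IH; congr (_ + (_ + _)).
    rewrite -unshuffleZ; apply: unshuffle_ext => I J _.
    rewrite (@coder_word_ext _ _ _ _ _
      (fun A => (s * sg x.1 (deg I)) *: G A (x :: J))) => [|v _ _ dv _].
      by rewrite coder_wordZ scalerA.
    by rewrite dv sgDr [sg x.1 Q]sgC.
  by apply: unshuffle_ext => I J _; rewrite coder_wordZ scalerA.
have -> : unshuffle (x :: w) (fun I J => coder_word Q q I (G^~ J)) =
    (a1 + (s *: b1 + c1)) + b3.
  rewrite /=; case: nilP => _; rewrite add0r unshuffleD unshuffleD unshuffleZ //.
have -> : unshuffle (x :: w) (fun I J => sg Q (deg I) *: coder_word Q q J (G I)) =
    p + (s *: b2 + (a2 + (s *: b4 + c2))).
  rewrite /=; congr (_ + (_ + _)).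
  - by rewrite /p deg_nil sg0r scale1r scaler0 !addr0.
  - by rewrite -unshuffleZ; apply: unshuffle_ext => I J _; rewrite deg_cons sgDr scalerA.
  - rewrite -unshuffleZ -!unshuffleD; apply: unshuffle_ext => I J _.
    rewrite !scalerDr !scalerA sgDl [_ * sg Q x.1]mulrC.
    by rewrite [sg x.1 _ * _]mulrC.
rewrite !(scalerDr s) scalerA sg_sqr scale1r !addrA.
by rewrite [LHS](ACl (2 * 4 * 8 * 6 * 1 * 5 * 3 * 7 * 9))%AC.
Qed.
End Insertion.

(** * Comparison with the sum over subsets of positions *)

Section SetsAsMasks.
Variables (K : fieldType) (m : nat) (W : gradedVect K m).
Local Notation Z := 'rV[int]_m.
Local Notation L := (Z * W)%type.
Local Notation sg := (@sg K m).

(** Sets of positions are turned into bit sequences, on which one can argue by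
    induction on the length. *)
Definition set_mask q (I : {set 'I_q}) : bitseq :=
  [seq i \in I | i <- enum 'I_q].

Lemma size_set_mask q (I : {set 'I_q}) : size (set_mask I) = q.
Proof. by rewrite size_map size_enum_ord. Qed.

Lemma nth_set_mask q (I : {set 'I_q}) (i : 'I_q) :
  nth false (set_mask I) i = (i \in I).
Proof. by rewrite (nth_map i) ?size_enum_ord // nth_ord_enum. Qed.

Lemma set_mask0 q : set_mask (finset.set0 : {set 'I_q}) = nseq q false.
Proof.
apply: (@eq_from_nth _ false) => [|i]; first by rewrite size_set_mask size_nseq.
rewrite size_set_mask => iq; rewrite (nth_set_mask _ (Ordinal iq)).
by rewrite finset.in_set0 nth_nseq if_same.
Qed.

Lemma set_maskC q (I : {set 'I_q}) :
  set_mask (~: I)%SET = map negb (set_mask I).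
Proof. by rewrite -map_comp; apply: eq_map => i; rewrite /= finset.in_setC. Qed.

Lemma subword_mask (w : seq W) (I : {set 'I_(size w)}) :
  subword I = mask (set_mask I) w.
Proof.
transitivity
  (mask (set_mask I) [seq nth 0 w i | i : 'I_(size w) <- enum 'I_(size w)]).
  by rewrite -map_mask -filter_mask /subword {1}enumT.
congr mask; rewrite -[RHS](mkseq_nth 0 w) /mkseq -val_enum_ord -map_comp //.
Qed.

Lemma sum_set_mask (E : nmodType) q (f : bitseq -> E) :
  \sum_(I : {set 'I_q}) f (set_mask I) = \sum_(t : q.-tuple bool) f t.
Proof.
rewrite (reindex (fun t : q.-tuple bool => [set i | tnth t i])) /=.
  apply: eq_bigr => t _; congr f; apply: (@eq_from_nth _ false).
    by rewrite size_set_mask size_tuple.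
  move=> i; rewrite size_set_mask => iq.
  by rewrite (nth_set_mask _ (Ordinal iq)) inE (tnth_nth false).
exists (fun I : {set 'I_q} => [tuple i \in I | i < q]) => [t _|I _].
  by apply/eq_from_tnth => i; rewrite tnth_mktuple inE.
by apply/setP => i; rewrite inE tnth_mktuple.
Qed.

Lemma sum_set_mask_rec (E : nmodType) q (f : bitseq -> E) :
  \sum_(I : {set 'I_q.+1}) f (set_mask I) =
    \sum_(I : {set 'I_q}) f (true :: set_mask I)
    + \sum_(I : {set 'I_q}) f (false :: set_mask I).
Proof.
rewrite sum_set_mask (sum_set_mask _ (fun b => f (true :: b))).
rewrite (sum_set_mask _ (fun b => f (false :: b))).
rewrite (reindex (fun p : bool * q.-tuple bool => [tuple of p.1 :: p.2])) /=.
  rewrite -(pair_bigA _ (fun b (t : q.-tuple bool) => f (b :: t))) /=.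
  by rewrite big_bool.
exists (fun t : q.+1.-tuple bool => (thead t, [tuple of behead t]))
  => [[b t] _|t _].
  by rewrite theadE; congr (_, _); apply: val_inj.
by rewrite -tuple_eta.
Qed.

Lemma sum_set_mask0 (E : nmodType) (f : bitseq -> E) :
  \sum_(I : {set 'I_0}) f (set_mask I) = f [::].
Proof.
rewrite sum_set_mask (big_pred1 [tuple]) // => t.
by rewrite [t]tuple0; apply/esym/eqP.
Qed.

Definition mask_sign (d : seq Z) (b : bitseq) : K :=
  \prod_(i < size b | nth false b i)
    \prod_(j < size b | ~~ nth false b j && (j < i)%N)
      sg (nth 0 d i) (nth 0 d j).

Lemma koszul_mask q d (I : {set 'I_q}) :
  koszul K d I = mask_sign d (set_mask I).
Proof.
rewrite /mask_sign size_set_mask; apply: eq_big => [i|i _].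
  by rewrite nth_set_mask.
by apply: eq_bigl => j; rewrite nth_set_mask finset.in_setC.
Qed.

Lemma mask_sign_cons a d b (s : bitseq) : size d = size s ->
  mask_sign (a :: d) (b :: s) =
    (if b then 1 else sg a (\sum_(c <- mask s d) c)) * mask_sign d s.
Proof.
move=> sd; rewrite /mask_sign /= big_mkcond big_ord_recl /=.
rewrite [X in (if b then X else 1)]big1 => [|j]; last by rewrite andbF.
rewrite if_same mul1r -big_mkcond /=.
under eq_bigr => i _ do rewrite big_mkcond big_ord_recl /= -big_mkcond andbT.
rewrite big_split; congr (_ * _) => /=.
case: b => /=; first by rewrite big1.
elim: s d sd => [|c s IH] [|e d] //= sd; first by rewrite big_ord0 big_nil sg0r.
case: sd => sd; rewrite big_mkcond big_ord_recl -big_mkcond /= IH //.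
by case: c; rewrite ?big_cons ?sgDr ?mul1r // sgC.
Qed.

(** The terms of the coproduct are indexed by the subsets of the positions
    of all letters but the last. *)
Lemma unshuffle_rcons (E : lmodType K) h l (G : seq L -> seq L -> E) :
  unshuffle (rcons h l) G = \sum_(I : {set 'I_(size h)})
    mask_sign (map fst h) (set_mask I) *:
      G (mask (set_mask I) h) (rcons (mask (map negb (set_mask I)) h) l).
Proof.
pose f h b G := mask_sign (map fst h) b *:
  (G (mask b h) (rcons (mask (map negb b) h) l) : E).
rewrite -/(f h _ G); elim: h G => [|x h IH] G.
  rewrite /= addr0 addr0 (sum_set_mask0 (fun b => f [::] b G)).
  by rewrite /f /mask_sign big_ord0 scale1r.
rewrite (sum_set_mask_rec _ (fun b => f (x :: h) b G)) /=.
have -> : nilp (rcons h l) = false by case: (h).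
rewrite add0r !IH; congr (_ + _); apply: eq_bigr => I _.
  by rewrite /f /= mask_sign_cons ?mul1r // size_map size_set_mask.
rewrite /f /= mask_sign_cons; last by rewrite size_map size_set_mask.
rewrite scalerA mulrC.
by rewrite -map_mask big_map.
Qed.
End SetsAsMasks.

Section Coproduct.
Variables (K : fieldType) (m : nat) (W : gradedVect K m).
Local Notation Z := 'rV[int]_m.
Local Notation L := (Z * W)%type.
Local Notation T := (tens_alg W).

Definition word (h : seq L) : T := tens (letters h).
Definition word2 (I J : seq L) : tensor T T := tprod (word I) (word J).

Lemma word_dmultilinear : dmultilinear word.
Proof. exact: (dmultilinear_letters (@tens_multilinear _ _)). Qed.

Lemma word_nil : word [::] = 0.
Proof. exact: tens_nil. Qed.

Lemma word2_dbimultilinear : dbimultilinear word2.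
Proof.
split=> [J|I]; first exact: (dmultilinear_comp (tprod_linearl (word J)) word_dmultilinear).
exact: (dmultilinear_comp (tprod_linearr (word I)) word_dmultilinear).
Qed.

(** The term of the empty set may be added freely since the empty word is
    zero in T.  No letter is moved past the last one, so a is arbitrary. *)
Lemma coproduct_rule h (x : W) a :
  \sum_(I : {set 'I_(size (letters h))} | I != finset.set0)
    koszul K (map fst h) I *:
      tprod (tens (subword I)) (tens (rcons (subword (~: I)) x)) =
  unshuffle (rcons h (a, x)) word2.
Proof.
have sE (I : {set 'I_(size (letters h))}) : koszul K (map fst h) I *:
      tprod (tens (subword I)) (tens (rcons (subword (~: I)) x)) =
    mask_sign K (map fst h) (set_mask I) *:
      word2 (mask (set_mask I) h) (rcons (mask (map negb (set_mask I)) h) (a, x)).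
  rewrite koszul_mask !subword_mask set_maskC /word2 /word /letters.
  by rewrite map_rcons !map_mask.
rewrite unshuffle_rcons big_mkcond /=.
pose f b := mask_sign K (map fst h) b *:
      word2 (mask b h) (rcons (mask (map negb b) h) (a, x)).
transitivity (\sum_(I : {set 'I_(size (letters h))}) f (set_mask I)).
  apply: eq_bigr => I _; case: eqP => // [->|_]; last exact: sE.
  rewrite /f set_mask0 mask_false.
  by rewrite /word2 word_nil (linear_fun0 (tprod_linearl _)) scaler0.
by rewrite -/f size_map.
Qed.

Lemma homog_letter_span (P : set W) : submodule P ->
  (forall a x, homog a x -> P x) -> forall x, P x.
Proof.
move=> PS PH x; have [xH xF ->] := componentP x.
have [s us sx] := finsupp_seq xF.
by rewrite (fsum_seq us sx); apply: submodule_sum => // a _; apply: PH (xH a).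
Qed.

(** The rule for the coproduct has an arbitrary last letter; both sides being
    linear in it, homogeneous ones suffice. *)
Lemma is_coproduct_homog_word Delta : linear Delta ->
  (is_coproduct Delta <->
   forall h, homog_word h -> Delta (word h) = unshuffle h word2).
Proof.
move=> DL; split=> [[_ DE] h|DE].
  case/lastP: h => [_|h [a x]]; first by rewrite word_nil linear_fun0.
  rewrite -cats1 => /homog_word_cat[hh _]; rewrite cats1.
  have /DE : homword (map fst h) (letters h) by apply/homwordP; exists h.
  by move/(_ x); rewrite (coproduct_rule h x a) /word /letters map_rcons.
split=> // d w x /homwordP[h [hh -> ->]].
rewrite (coproduct_rule h x 0).
apply: (@homog_letter_span
  [set y | Delta (tens (rcons (letters h) y)) = unshuffle (rcons h (0, y)) word2]).
  apply: submodule_eq => [c y z|c y z].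
    by rewrite -!cats1 tens_multilinear DL.
  by rewrite -!cats1; apply: unshuffle_dmultilinear; exact: word2_dbimultilinear.
move=> a y ya /=; rewrite -(coproduct_rule h y 0) (coproduct_rule h y a) -DE.
  by rewrite /word /letters map_rcons.
by rewrite -cats1; apply/homog_word_cat.
Qed.

Lemma coproduct_is_coproduct : is_coproduct (@coproduct K m W).
Proof.
apply: (@xgetPex (T -> tensor T T : choiceType)).
have [//||D DL DE] := @homog_word_lift _ _ W _ (fun h => unshuffle h word2).
  by apply: unshuffle_dmultilinear; exact: word2_dbimultilinear.
by exists D; apply/(is_coproduct_homog_word DL).
Qed.

Lemma coproduct_linear : linear (@coproduct K m W).
Proof. by case: coproduct_is_coproduct. Qed.

Lemma coproduct_word h : homog_word h -> coproduct (word h) = unshuffle h word2.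
Proof.
have /(is_coproduct_homog_word coproduct_linear) H := coproduct_is_coproduct.
exact: H.
Qed.
End Coproduct.

(** * Coderivations and their corestrictions *)

Section Coderivations.
Variables (K : fieldType) (m : nat) (W : gradedVect K m).
Local Notation Z := 'rV[int]_m.
Local Notation L := (Z * W)%type.
Local Notation T := (tens_alg W).
Local Notation sg := (@sg K m).
Local Notation word := (@word K m W).
Local Notation word2 := (@word2 K m W).

Lemma tens_homog_submodule a : submodule (@tens_homog K m W a).
Proof. exact: submodule_linspan. Qed.

Lemma tens_homog_word h : homog_word h -> tens_homog (deg h) (word h).
Proof.
move=> hh; apply: mem_linspan; exists (map fst h), (letters h); split=> //.
  by apply/homwordP; exists h.
by rewrite big_map.
Qed.

Lemma tens_homog_ind a (P : set T) : submodule P ->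
  (forall h, homog_word h -> deg h = a -> P (word h)) ->
  forall x, tens_homog a x -> P x.
Proof.
move=> PS Ph x; apply: linspan_sub => // _ [d [w [/homwordP[h [hh -> ->]] sa ->]]].
by apply: Ph; rewrite // -sa big_map.
Qed.

Lemma tens_homog_span (P : set T) : submodule P ->
  (forall a x, tens_homog a x -> P x) -> forall x, P x.
Proof.
move=> PS Ph; apply: homog_word_span => // h hh.
exact: Ph (tens_homog_word hh).
Qed.

Lemma tensor_homog_ext (E : lmodType K) (F G : tensor T T -> E) :
  linear F -> linear G ->
  (forall a x y, tens_homog a x -> F (tprod x y) = G (tprod x y)) -> F =1 G.
Proof.
move=> FL GL FG; apply: (tensor_span (submodule_eq FL GL)) => x y.
apply: (tens_homog_span
  (submodule_preimage (tprod_linearl y) (submodule_eq FL GL))) => a z.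
exact: FG.
Qed.

(** Makes the sign of id (x) g a linear operation on the left factor. *)
Lemma twist_exists b : exists2 t : T -> T, linear t &
  forall a x, tens_homog a x -> t x = sg b a *: x.
Proof.
have [||t tL tE] := @homog_word_lift _ _ W _ (fun h => sg b (deg h) *: word h).
- by rewrite word_nil scaler0.
- by apply: dmultilinear_sg; exact: word_dmultilinear.
exists t => // a; apply: tens_homog_ind => [|h hh <-]; last exact: tE.
by apply: submodule_eq => // c x y; rewrite scalerDr !scalerA [c * _]mulrC.
Qed.

Lemma tmapP b (f g : T -> T) : linear f -> linear g ->
  is_tmap b f g (tmap b f g).
Proof.
move=> fL gL; apply: (@xgetPex (tensor T T -> tensor T T : choiceType)).
have [t tL tE] := twist_exists b.
have [y c x z|x c y z|h hL hE] :=
  @tensor_lift K T T _ (fun x y => tprod (f (t x)) (g y)).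
- by rewrite tL fL tprod_linearl.
- by rewrite gL tprod_linearr.
exists h; split=> // a x y xa.
by rewrite hE (tE a) // (linear_funZ fL) (linear_funZ (tprod_linearl _)).
Qed.

Lemma idL : linear (id : T -> T).
Proof. by []. Qed.

Definition leibniz Q (D : T -> T) (t : tensor T T) : tensor T T :=
  tmap 0 D id t + tmap Q id D t.

Lemma leibniz_linear Q D : linear D -> linear (leibniz Q D).
Proof.
move=> DL; have [hL _] := tmapP 0 DL idL; have [kL _] := tmapP Q idL DL.
by move=> c x y; rewrite /leibniz hL kL scalerDr addrACA.
Qed.

Lemma leibniz_tprod Q D a x y : linear D -> tens_homog a x ->
  leibniz Q D (tprod x y) = tprod (D x) y + sg Q a *: tprod x (D y).
Proof.
move=> DL xa; have [_ hE] := tmapP 0 DL idL; have [_ kE] := tmapP Q idL DL.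
rewrite /leibniz (hE a) // (kE a) //.
by rewrite -[sgn K (ip 0 a)]/(sg 0 a) sg0l scale1r.
Qed.
Lemma leibniz_unsh Q (D : T -> T) h : linear D -> homog_word h ->
  leibniz Q D (unshuffle h word2) =
    unshuffle h (fun I J => tprod (D (word I)) (word J))
    + unshuffle h (fun I J => sg Q (deg I) *: tprod (word I) (D (word J))).
Proof.
move=> DL hh; rewrite (unshuffle_map _ _ (leibniz_linear Q DL)) -unshuffleD.
apply: unshuffle_ext => I J [_ _ _ /(_ hh)[hI hJ]].
exact: leibniz_tprod (tens_homog_word hI).
Qed.

Lemma is_coder_leibniz_word Q (D : T -> T) : linear D ->
  (forall h, homog_word h -> tens_homog (deg h + Q) (D (word h))) ->
  (forall h, homog_word h -> coproduct (D (word h)) =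
    unshuffle h (fun I J => tprod (D (word I)) (word J))
    + unshuffle h (fun I J => sg Q (deg I) *: tprod (word I) (D (word J)))) ->
  is_coder Q D.
Proof.
move=> DL DW DD; split=> // [a x|x].
  move: x; apply: tens_homog_ind => [|h hh <-]; last exact: DW.
  exact: submodule_preimage DL (tens_homog_submodule _).
rewrite -/(leibniz Q D (coproduct x)); move: x.
apply: homog_word_ext => [c x y|c x y|h hh].
- by rewrite DL coproduct_linear.
- by rewrite coproduct_linear leibniz_linear.
by rewrite -/(word h) DD // -leibniz_unsh // coproduct_word.
Qed.

Lemma coder_leibniz_word Q (D : T -> T) h : is_coder Q D -> homog_word h ->
  coproduct (D (word h)) =
    unshuffle h (fun I J => tprod (D (word I)) (word J))
    + unshuffle h (fun I J => sg Q (deg I) *: tprod (word I) (D (word J))).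
Proof.
move=> [DL _ DD] hh; rewrite DD -/(leibniz Q D _) coproduct_word //.
exact: leibniz_unsh.
Qed.

Definition weighted Q (q : seq L -> W) : Prop :=
  forall u, homog_word u -> homog (Q + deg u) (q u).

(** All terms have the right degree: the class of the sum modulo elements of
    that degree is the sum of the classes, which vanish. *)
Lemma coder_word_tens_homog Q q h : weighted Q q -> homog_word h ->
  tens_homog (deg h + Q) (coder_word Q q h word).
Proof.
move=> qH hh; set S := tens_homog _.
pose p := modquot_pi S.
have pS x : S x -> p x = 0 by exact: modquot_pi_rel.
have : p (coder_word Q q h word) = p 0.
  rewrite /p (coder_word_map _ _ _ _ (modquot_pi_linear S))
    (linear_fun0 (modquot_pi_linear S)).
  rewrite -[RHS](coder_word0 _ Q q h); apply: coder_word_ext => v _ _ dv /(_ qH hh) hv.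
  by apply: pS; rewrite /S addrC -dv; exact: tens_homog_word.
move=> /modquot_piP; rewrite subr0.
by apply: linspan_sub => //; exact: tens_homog_submodule.
Qed.

Lemma corestr_word l : corestr (word [:: l]) = l.2.
Proof. exact: corestr1. Qed.

Lemma corestr_word_size h : size h <> 1%N -> corestr (word h) = 0.
Proof. by move=> sh; apply: corestr_size; rewrite size_map; apply/eqP. Qed.

Lemma coder_exists Q q : dmultilinear q -> weighted Q q ->
  exists D, [/\ is_coder Q D,
    forall h, homog_word h -> D (word h) = coder_word Q q h word &
    forall h, homog_word h -> h <> [::] -> corestr (D (word h)) = q h].
Proof.
move=> qM qH.
have [//||D DL DE] := @homog_word_lift _ _ W _ (fun h => coder_word Q q h word).
  by apply: coder_word_dmultilinear => //; exact: word_dmultilinear.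
exists D; split=> [||h hh h0]; last first.
- rewrite DE // (coder_word_map _ _ _ _ (@corestr_linear _ W)) coder_word_single //.
    exact: corestr_word.
  by move=> v v1; apply: corestr_word_size => v2; rewrite v2 in v1.
- exact: DE.
apply: is_coder_leibniz_word => // h hh; first by
  rewrite DE //; exact: coder_word_tens_homog.
rewrite DE // (coder_word_map _ _ _ _ (@coproduct_linear _ _ W)).
rewrite (@coder_word_ext _ _ _ _ _ _ _ _ (fun v => unshuffle v word2)); last first.
  by move=> v _ _ _ /(_ qH hh); apply: coproduct_word.
rewrite coder_word_unshuffle.
congr (_ + _); apply: unshuffle_ext => I J [_ _ _ /(_ hh)[hI hJ]].
  by rewrite DE // (coder_word_map _ _ _ _ (tprod_linearl (word J))).
by rewrite DE // (coder_word_map _ _ _ _ (tprod_linearr (word I))).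
Qed.

Lemma append_letter_exists (z : W) : exists2 f : T -> T, linear f &
  forall w, f (tens w) = if w is [::] then 0 else tens (rcons w z).
Proof.
apply: tens_lift => // u v c x y; rewrite -!cats1 -!catA !cat_cons.
by case: u => [|t u]; apply: tens_multilinear.
Qed.

(** Appending the corestriction of the right factor to the left factor.  The
    empty word must be sent to zero as it is zero in T. *)
Lemma append_corestr_exists : exists2 f : tensor T T -> T, linear f &
  forall x y z, corestr y = z -> forall w, x = tens w ->
    f (tprod x y) = if w is [::] then 0 else tens (rcons w z).
Proof.
have /choice[f fP] : forall z : W, exists f : T -> T, linear f /\
    forall w, f (tens w) = if w is [::] then 0 else tens (rcons w z).
  by move=> z; have [f fL fE] := append_letter_exists z; exists f.
have fl x : linear (f^~ x).
  move=> c y z; pose g t := c *: f y t + f z t.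
  have gL : linear g.
    move=> d s t; rewrite /g (fP y).1 (fP z).1 !scalerDr !scalerA [d * c]mulrC.
    by rewrite addrACA.
  apply: (tens_span (submodule_eq (fP (c *: y + z)).1 gL)) x => w /=.
  rewrite /g !(fP _).2; case: w => [|t w]; first by rewrite scaler0 addr0.
  by rewrite -!cats1 tens_multilinear.
have [y|x c y z|g gL gE] :=
  @tensor_lift K T T _ (fun x y => f (corestr y) x); first exact: (fP _).1.
  by rewrite corestr_linear fl.
by exists g => // x y z <- w ->; rewrite gE (fP _).2.
Qed.

Lemma unshuffle0 (E : lmodType K) (h : seq L) : unshuffle h (fun _ _ => 0 : E) = 0.
Proof.
rewrite -[RHS](scale0r (unshuffle h (fun _ _ => 0 : E))) -unshuffleZ.
by apply: unshuffle_ext => I J _; rewrite scaler0.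
Qed.

Lemma unshuffle_last (E : lmodType K) h l (G : seq L -> seq L -> E) :
  (forall I J, (1 < size J)%N -> G I J = 0) -> unshuffle (rcons h l) G = G h [:: l].
Proof.
elim: h G => [|x h IH] G G0 /=; first by rewrite !addr0.
have -> : nilp (rcons h l) = false by case: (h).
rewrite add0r IH => [|I J]; last exact: G0.
rewrite -[RHS]addr0; congr (_ + _); rewrite -[RHS](unshuffle0 E (rcons h l)).
apply: unshuffle_ext => I J [_ J0 _ _]; rewrite G0 ?scaler0 //.
by case: J J0.
Qed.

(** In the coproduct of a word only the term whose right factor is the last
    letter contributes, and appending that letter restores the word, unless it
    has one letter; such a word is its own corestriction. *)
Lemma reconstruct_exists : exists2 f : tensor T T -> T, linear f &
  (forall x y y', corestr y = corestr y' -> f (tprod x y) = f (tprod x y')) /\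
  (forall t, t = tens [:: corestr t] + f (coproduct t)).
Proof.
have [f fL fE] := append_corestr_exists; exists f => //; split.
  move=> x y y' yy'.
  apply: (tens_span (submodule_eq (f := fun x => f (tprod x y))
    (g := fun x => f (tprod x y')) _ _)) x => [c u v|c u v|w] /=.
  - by rewrite tprod_linearl fL.
  - by rewrite tprod_linearl fL.
  by rewrite !(fE _ _ _ erefl _ erefl) yy'.
apply: homog_word_ext => [//|c x y|h hh].
  have := @tens_multilinear K W [::] [::] => /= t1.
  by rewrite corestr_linear t1 coproduct_linear fL scalerDr addrACA.
rewrite -/(word h) coproduct_word // (unshuffle_map _ _ fL).
have t0 : tens [:: 0] = 0 :> T.
  by apply: (@dmultilinear0 _ _ W _ word [::] [::] 0); exact: word_dmultilinear.
case/lastP: h hh => [|h l] hh.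
  by rewrite word_nil (linear_fun0 (@corestr_linear _ W)) t0 addr0.
rewrite unshuffle_last => [|I J sJ]; last first.
  have J0 : corestr (word J) = 0.
    by apply: corestr_word_size => s1; rewrite s1 in sJ.
  rewrite (fE _ _ _ J0 _ erefl); case: (letters I) => // x w.
  apply: (@linear_fun0 _ _ _ (fun z => tens (rcons (x :: w) z))) => c y z.
  by rewrite -!cats1; apply: tens_multilinear.
rewrite (fE _ _ _ (corestr_word l) _ erefl).
case: h {hh} => [|x h]; first by rewrite corestr_word addr0.
rewrite corestr_word_size /= ?size_rcons // t0 add0r.
by rewrite /word /letters /= map_rcons.
Qed.

(** Applying the reconstruction formula to D(w), the coproduct identity
    expresses D(w) by corestrictions of D and by values of D at shorter words. *)
Lemma coder_unique Q D D' : is_coder Q D -> is_coder Q D' ->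
  (forall h, homog_word h -> corestr (D (word h)) = corestr (D' (word h))) -> D = D'.
Proof.
move=> DC DC' DD; have [f fL [fr fE]] := reconstruct_exists.
have [DL _ _] := DC; have [DL' _ _] := DC'.
apply/funext; apply: homog_word_ext => // h; rewrite -/(word h).
have [n] := ubnP (size h); elim: n h => // n IH h; rewrite ltnS => hn hh.
rewrite [LHS]fE [RHS]fE DD // (coder_leibniz_word DC hh).
rewrite (coder_leibniz_word DC' hh); congr (_ + _).
rewrite !(linear_funD fL) !(unshuffle_map _ _ fL).
congr (_ + _); apply: unshuffle_ext => I J [sIJ J0 _ /(_ hh)[hI hJ]].
  rewrite IH // (leq_trans _ hn) // -sIJ -addn1 leq_add2l.
  by case: J J0 {sIJ hJ}.
by rewrite !(linear_funZ fL); congr (_ *: _); apply: fr; apply: DD.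
Qed.

Lemma leibniz_lin Q c (D D' : T -> T) t : linear D -> linear D' ->
  leibniz Q (fun x => c *: D x + D' x) t = c *: leibniz Q D t + leibniz Q D' t.
Proof.
move=> DL DL'; have L : linear (fun x => c *: D x + D' x).
  move=> d x y; rewrite DL DL' !scalerDr !scalerA [d * c]mulrC.
  by rewrite addrACA.
move: t; apply: tensor_homog_ext => [|d x y|a x y xa]; first exact: leibniz_linear.
  rewrite !leibniz_linear // !scalerDr !scalerA [d * c]mulrC.
  by rewrite addrACA.
rewrite !(leibniz_tprod _ _ _ xa) // tprod_linearl tprod_linearr.
by rewrite !scalerDr !scalerA [c * _]mulrC addrACA.
Qed.

Lemma is_coder_lin Q c (D D' : T -> T) : is_coder Q D -> is_coder Q D' ->
  is_coder Q (fun x => c *: D x + D' x).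
Proof.
move=> [DL DW DD] [DL' DW' DD']; split=> [d x y|a x xa|x].
- by rewrite DL DL' !scalerDr !scalerA [d * c]mulrC addrACA.
- have [_] := tens_homog_submodule (a + Q); apply; [exact: DW|exact: DW'].
- by rewrite coproduct_linear DD DD' -!/(leibniz _ _ _) -leibniz_lin.
Qed.

Lemma is_coder0 Q : is_coder Q (fun=> 0 : T).
Proof.
apply: is_coder_leibniz_word => [c x y|h hh|h hh]; first by rewrite scaler0 addr0.
  by case: (tens_homog_submodule (deg h + Q)).
rewrite (linear_fun0 (@coproduct_linear _ _ W)) -unshuffleD.
rewrite -[LHS](unshuffle0 _ h); apply: unshuffle_ext => I J _.
rewrite (linear_fun0 (tprod_linearl _)) (linear_fun0 (tprod_linearr _)).
by rewrite scaler0 addr0.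
Qed.

(** The mixed terms D'(x) (x) D(y) and D(x) (x) D'(y) cancel in the graded
    commutator of the two Leibniz operators. *)
Lemma comm_coder Q R (D D' : T -> T) : is_coder Q D -> is_coder R D' ->
  is_coder (Q + R) (comm Q R D D').
Proof.
move=> [DL DW DD] [DL' DW' DD'].
have CL : linear (comm Q R D D').
  exact: linear_comm.
split=> // [a x xa|x].
  rewrite /comm -scaleN1r scalerA; apply: (submoduleD (tens_homog_submodule _)).
    by rewrite [Q + R]addrC addrA; exact: (DW _ _ (DW' _ _ xa)).
  apply: (submoduleZ _ (tens_homog_submodule _)); rewrite addrA.
  exact: (DW' _ _ (DW _ _ xa)).
rewrite -/(leibniz _ _ _) {1}/comm (linear_funB (@coproduct_linear _ _ W)).
rewrite (linear_funZ (@coproduct_linear _ _ W)) DD DD' DD' DD -!/(leibniz _ _ _).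
have LL := leibniz_linear Q DL; have LL' := leibniz_linear R DL'.
move: (coproduct x) => {x}; apply: tensor_homog_ext => [c s t|c s t|a x y xa].
- exact: (linear_comm _ LL LL').
- by rewrite leibniz_linear.
rewrite !(leibniz_tprod _ _ _ xa) // (linear_funD LL) (linear_funD LL').
rewrite (linear_funZ LL) (linear_funZ LL') !(leibniz_tprod _ _ _ xa) //.
rewrite (leibniz_tprod _ _ _ (DW _ _ xa)) // (leibniz_tprod _ _ _ (DW' _ _ xa)) //.
rewrite /comm -[sgn K (ip Q R)]/(sg Q R) (linear_funB (tprod_linearl y)).
rewrite (linear_funZ (tprod_linearl y)) (linear_funB (tprod_linearr x)).
rewrite (linear_funZ (tprod_linearr x)) !sgDr sgDl [sg R Q]sgC.
rewrite !scalerDr !scalerN !scalerA !opprD.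
have -> : sg Q R * (sg R a * sg Q R) = sg R a by rewrite mulrCA sg_sqr mulr1.
rewrite [sg Q a * sg Q R]mulrC [sg R a * sg Q a]mulrC.
rewrite [_ * sg R a * sg Q R]mulrC !mulrA !addrA.
(* The last two pairs are the mixed terms with opposite signs. *)
by rewrite [LHS](ACl (1 * 5 * 4 * 8 * 2 * 7 * 3 * 6))%AC /= !addrK.
Qed.
End Coderivations.

(** * Multilinear maps on V and corestrictions on the desuspension *)

Section Phi.
Variables (K : fieldType) (n : nat) (V : gradedVect K n.+1).
Local Notation Z := 'rV[int]_n.+1.
Local Notation W := (desusp V).
Local Notation L := (Z * W)%type.
Local Notation T := (tens_alg W).
Local Notation sg := (@sg K n.+1).
Local Notation word := (@word K n.+1 W).
Local Notation e1 := (e1 n).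
Implicit Types (pi rho : nat -> seq V -> V) (h : seq L).

(** The sign relating a multilinear map on V to its corestriction on the
    desuspension. *)
Definition susp_sign (h : seq L) : K :=
  (-1) ^+ (size h * (size h).-1)./2 * susp_sgn K (map fst h).

Definition corestr_of (pi : nat -> seq V -> V) (h : seq L) : W :=
  susp_sign h *: pi (size h).-1 (letters h).

(** The weight Q - k e1 of a (k+1)-linear map on V is the weight Q of the
    corresponding corestriction, once the k + 1 arguments and the value are
    desuspended. *)
Lemma deg_suspend Q (d : seq Z) k : size d = k.+1 ->
  Q - e1 *+ k + \sum_(b <- [seq b + e1 | b <- d]) b = Q + \sum_(b <- d) b + e1.
Proof.
move=> sd; have -> : \sum_(b <- [seq b + e1 | b <- d]) b =
    \sum_(b <- d) b + e1 *+ size d.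
  elim: d {sd} => [|a d IH] /=; first by rewrite !big_nil addr0.
  by rewrite !big_cons IH mulrS addrACA.
by rewrite sd mulrSr [X in _ + X]addrCA !addrA subrK.
Qed.

Lemma susp_sgn_sqr (d : seq Z) : susp_sgn K d * susp_sgn K d = 1.
Proof.
elim: d => [|a d IH] /=; first by rewrite mulr1.
by rewrite mulrACA sgn_sqr mul1r.
Qed.

Lemma susp_sign_sqr h : susp_sign h * susp_sign h = 1.
Proof. by rewrite mulrACA susp_sgn_sqr mulr1 -expr2 sqrr_sign. Qed.

Lemma Mult_nil A a (f : seq V -> V) : Mult A a f -> f [::] = 0.
Proof. by case=> f0 _ _; apply: f0. Qed.

Lemma Mult_multilinear A a (f : seq V -> V) : Mult A a f -> multilinear f.
Proof.
move=> [f0 fl _] u v c x y; have [uv|uv] := (size u + size v)%N =P a.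
  exact: fl.
by rewrite !f0 ?scaler0 ?addr0 // size_cat /= addnS => -[].
Qed.

Lemma corestr_of_dmultilinear Q pi : Cdeg Q pi -> dmultilinear (corestr_of pi).
Proof.
move=> piC u v a c x y.
pose p w := susp_sign (u ++ (a, x) :: v) *: pi (size u + size v)%N w.
have pE z : corestr_of pi (u ++ (a, z) :: v) = p (letters (u ++ (a, z) :: v)).
  rewrite /corestr_of /p /susp_sign !size_cat !map_cat /= !addnS /=.
  by [].
rewrite !pE /p /letters !map_cat /= (Mult_multilinear (piC _)) scalerDr !scalerA.
by rewrite mulrC.
Qed.

Lemma corestr_of_weighted Q pi : Cdeg Q pi -> weighted Q (corestr_of pi).
Proof.
move=> piC h hh; rewrite /corestr_of.
apply: homogZ.
case: h hh => [|l h] hh.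
  by rewrite (Mult_nil (piC 0%N)); exact: homog0.
have [_ _ pw] := piC (size h).
have := pw [seq b + e1 | b <- map fst (l :: h)] (letters (l :: h)).
rewrite size_map => /(_ erefl).
have hw : homword (W := V) [seq b + e1 | b <- map fst (l :: h)]
    (letters (l :: h)).
  have [sd dw] : homword (W := W) (map fst (l :: h)) (letters (l :: h)).
    by apply/homwordP; exists (l :: h).
  split; first by rewrite size_map.
  by move=> i iw; rewrite (nth_map 0) ?sd //; apply: dw.
move=> /(_ hw); congr homog.
by rewrite (deg_suspend Q) ?size_map // big_map.
Qed.

Lemma has_corestr_homog_word pi (D : T -> T) : has_corestr pi D <->
  forall h, homog_word h -> h <> [::] -> corestr (D (word h)) = corestr_of pi h.
Proof.
split=> [DE h hh h0|DE a d w sw /homwordP[h [hh -> wE]]].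
  rewrite (DE (size h).-1 (map fst h)).
  - by rewrite /corestr_of /susp_sign; case: (h) h0.
  - by rewrite size_map; case: (h) h0.
  - by apply/homwordP; exists h.
have sh : size h = a.+1 by rewrite -sw wE size_map.
rewrite wE DE // => [|h0]; last by rewrite h0 in sh.
by rewrite /corestr_of /susp_sign sh.
Qed.

Lemma coder_corestr Q pi (D : T -> T) h : is_coder Q D -> has_corestr pi D ->
  Cdeg Q pi -> homog_word h -> corestr (D (word h)) = corestr_of pi h.
Proof.
move=> [DL _ _] /has_corestr_homog_word DE piC hh.
have [->|/eqP h0] := eqVneq h [::]; last exact: DE.
rewrite word_nil (linear_fun0 DL) (linear_fun0 (@corestr_linear _ W)).
by rewrite /corestr_of (Mult_nil (piC _)) scaler0.
Qed.

Lemma phi_degP Q pi : Cdeg Q pi ->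
  is_coder Q (phi_deg Q pi) /\ has_corestr pi (phi_deg Q pi).
Proof.
move=> piC; apply: (@xgetPex (T -> T : choiceType) 0
  [set D | is_coder Q D /\ has_corestr pi D]).
have [D [DC _ DE]] := coder_exists (corestr_of_dmultilinear piC) (corestr_of_weighted piC).
by exists D; split=> //; apply/has_corestr_homog_word.
Qed.

Lemma phi_deg_corestr Q pi h : Cdeg Q pi -> homog_word h ->
  corestr (phi_deg Q pi (word h)) = corestr_of pi h.
Proof.
by move=> piC; have [DC DE] := phi_degP piC; exact: (coder_corestr DC).
Qed.

Lemma phi_deg_unique Q pi D : Cdeg Q pi -> is_coder Q D ->
  (forall h, homog_word h -> corestr (D (word h)) = corestr_of pi h) ->
  phi_deg Q pi = D.
Proof.
move=> piC DC DE; have [PC _] := phi_degP piC.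
by apply: (coder_unique PC DC) => h hh; rewrite DE // phi_deg_corestr.
Qed.

Lemma corestr_of_inj Q pi rho : Cdeg Q pi -> Cdeg Q rho ->
  (forall h, homog_word h -> corestr_of pi h = corestr_of rho h) -> pi = rho.
Proof.
move=> piC rhoC pr; apply/funext => a; apply/funext => w.
have [f fL fE] := tens_lift (Mult_nil (piC a)) (Mult_multilinear (piC a)).
have [g gL gE] := tens_lift (Mult_nil (rhoC a)) (Mult_multilinear (rhoC a)).
rewrite -fE -gE; have /(_ fL gL) := @homog_word_ext _ _ W V f g; apply => h hh.
rewrite fE gE; have [sh|sh] := size (letters h) =P a.+1; last first.
  have [p0 _ _] := piC a; have [r0 _ _] := rhoC a.
  by rewrite p0 // r0.
have := congr1 (fun x => susp_sign h *: x) (pr h hh).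
rewrite /corestr_of !scalerA susp_sign_sqr !scale1r.
by rewrite size_map in sh; rewrite sh.
Qed.

Lemma corestr_homog a (x : T) : tens_homog a x -> homog (g := W) a (corestr x).
Proof.
apply: (@tens_homog_ind _ _ W a [set x | homog (g := W) a (corestr x)]).
  apply: submodule_preimage (@corestr_linear _ W) _.
  exact: grading_submodule (homogP W) a.
move=> h hh <- /=; have [h1|h1] := size h =P 1%N; last first.
  by rewrite corestr_word_size //; exact: homog0.
case: h hh h1 => [|l [|l' h]] //= [lh _] _.
by rewrite corestr_word deg_cons deg_nil addr0.
Qed.

(** Undoing the suspension sign requires a linear operator on T multiplying each
    homogeneous word by it. *)
Lemma coder_has_corestr Q (D : T -> T) : is_coder Q D ->
  exists2 pi, Cdeg Q pi &
    forall h, homog_word h -> corestr (D (word h)) = corestr_of pi h.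
Proof.
move=> DC; have [DL DW _] := DC.
have [||S SL SE] := @homog_word_lift _ _ W T (fun h => susp_sgn K (map fst h) *: word h).
- by rewrite word_nil scaler0.
- by apply: dmultilinear_degs; exact: word_dmultilinear.
pose f w : V := corestr (D (S (tens (w : seq W)))).
have fM : multilinear f.
  move=> u v c x y; rewrite /f (tens_multilinear (W := W)) SL DL.
  exact: (@corestr_linear _ W).
pose pi a (w : seq V) : V :=
  if size w == a.+1 then (-1) ^+ (a.+1 * a)./2 *: f w else 0.
have piC : Cdeg Q pi.
  move=> a; split=> [w /eqP/negPf sw|u v c x y uv|d w sw dw].
  - by rewrite /pi sw.
  - by rewrite /pi !size_cat /= !addnS uv eqxx fM scalerDr !scalerA mulrC.
  rewrite /pi sw eqxx.
  apply: homogZ; rewrite /f.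
  have dw' : homword (W := W) [seq b - e1 | b <- d] w.
    have [sd dw'] := dw; split=> [|i iw]; first by rewrite size_map.
    by rewrite (nth_map 0) ?sd //=; rewrite subrK; apply: dw'.
  have [h [hh dE wE]] : exists h,
      [/\ homog_word h, [seq b - e1 | b <- d] = map fst h & w = letters h].
    exact/homwordP.
  have dE' : d = [seq b + e1 | b <- map fst h].
    by rewrite -dE -map_comp map_id_in // => b _; rewrite /= subrK.
  rewrite wE SE // (linear_funZ DL) (linear_funZ (@corestr_linear _ W)).
  apply: homogZ; rewrite dE' (deg_suspend Q) ?size_map; last first.
    by rewrite -sw wE size_map.
  rewrite big_map [Q + _]addrC.
  exact: corestr_homog (DW _ _ (tens_homog_word hh)).
exists pi => // h hh.
have [->|/eqP h0] := eqVneq h [::].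
  rewrite word_nil (linear_fun0 DL) (linear_fun0 (@corestr_linear _ W)).
  by rewrite /corestr_of (Mult_nil (piC _)) scaler0.
have sh : size h = (size h).-1.+1 by case: (h) h0.
rewrite /corestr_of /pi size_map -sh eqxx /f SE // (linear_funZ DL).
rewrite (linear_funZ (@corestr_linear _ W)) !scalerA -mulrA.
by rewrite -/(susp_sign h) susp_sign_sqr scale1r.
Qed.
End Phi.

(** * The graded Lie algebra of coderivations *)

Section Commutator.
Variables (K : fieldType) (m : nat) (W : gradedVect K m).
Local Notation Z := 'rV[int]_m.
Local Notation T := (tens_alg W).
Local Notation sg := (@sg K m).
Implicit Types (D : Z -> T -> T).

Lemma comm0l Q R (f : T -> T) : linear f -> comm Q R 0 f = 0.
Proof.
move=> fL; apply/funext => x.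
by rewrite /comm /= (linear_fun0 fL) scaler0 subr0.
Qed.

Lemma comm0r Q R (f : T -> T) : linear f -> comm Q R f 0 = 0.
Proof.
move=> fL; apply/funext => x.
by rewrite /comm /= (linear_fun0 fL) scaler0 subr0.
Qed.

Lemma CoDer_linear D Q : is_CoDer D -> linear (D Q).
Proof. by move=> [/(_ Q)[]]. Qed.

Lemma commutator_finsupp D D' S x : is_CoDer D -> is_CoDer D' ->
  finsupp (fun Q => comm Q (S - Q) (D Q) (D' (S - Q)) x).
Proof.
move=> [_ DF] DC'; apply: sub_finite_set DF => Q /= cQ DQ; apply: cQ.
by rewrite DQ comm0l //; exact: CoDer_linear.
Qed.

Lemma commutator_coder D D' S : is_CoDer D -> is_CoDer D' ->
  is_coder S (commutator D D' S).
Proof.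
move=> DC DC'; have [s us sD] := @finsupp_seq K Z (T -> T) D DC.2.
have -> : commutator D D' S =
    (fun x => \sum_(Q <- s) comm Q (S - Q) (D Q) (D' (S - Q)) x).
  apply/funext => x; apply: fsum_seq => // Q cQ; apply: sD => DQ; apply: cQ.
  by rewrite DQ comm0l //; exact: CoDer_linear.
elim: s {us sD} => [|Q s IH].
  have -> : (fun x => \sum_(Q <- [::]) comm Q (S - Q) (D Q) (D' (S - Q)) x) =
    (fun=> 0) by apply/funext => x; rewrite big_nil.
  exact: is_coder0.
have CC : is_coder S (comm Q (S - Q) (D Q) (D' (S - Q))).
  have := comm_coder (DC.1 Q) (DC'.1 (S - Q)).
  by rewrite addrC subrK.
have := is_coder_lin 1 CC IH; congr is_coder; apply/funext => x.
by rewrite big_cons scale1r.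
Qed.

Lemma commutator_CoDer D D' : is_CoDer D -> is_CoDer D' ->
  is_CoDer (commutator D D').
Proof.
move=> DC DC'; split=> [S|]; first exact: commutator_coder.
have [s us sD] := @finsupp_seq K Z (T -> T) D DC.2.
have [t ut tD] := @finsupp_seq K Z (T -> T) D' DC'.2.
apply: sub_finite_set (finite_seq [seq Q + R | Q <- s, R <- t]) => S /= cS.
apply: contrapT => /negP St; apply: cS; apply/funext => x.
rewrite /commutator fsbig1 // => Q _.
have [DQ|/sD Qs] := pselect (D Q = 0).
  by rewrite DQ comm0l //; exact: CoDer_linear.
have [DR|/tD Rt] := pselect (D' (S - Q) = 0).
  by rewrite DR comm0r //; exact: CoDer_linear.
case/negP: St; apply/allpairsP; exists (Q, S - Q); split=> //=.
by rewrite addrC subrK.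
Qed.

Lemma commutator_linearl D' c D1 D2 :
  is_CoDer D1 -> is_CoDer D2 -> is_CoDer D' ->
  commutator (c *: D1 + D2) D' = c *: commutator D1 D' + commutator D2 D'.
Proof.
move=> D1C D2C DC'; apply/funext => S; apply/funext => x.
rewrite [RHS](_ : _ = c *: commutator D1 D' S x + commutator D2 D' S x) //.
rewrite /commutator -fsum_linear; [|exact: commutator_finsupp..].
apply: eq_fsbigr => Q _; rewrite /comm.
rewrite -[(c *: D1 + D2) Q _]/(c *: D1 Q _ + D2 Q _).
rewrite -[(c *: D1 + D2) Q _]/(c *: D1 Q _ + D2 Q _).
rewrite (CoDer_linear (S - Q) DC') !scalerDr !scalerN !scalerA.
by rewrite opprD [c * _]mulrC addrACA.
Qed.

Lemma commutator_linearr D c D1 D2 :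
  is_CoDer D1 -> is_CoDer D2 -> is_CoDer D ->
  commutator D (c *: D1 + D2) = c *: commutator D D1 + commutator D D2.
Proof.
move=> D1C D2C DC; apply/funext => S; apply/funext => x.
rewrite [RHS](_ : _ = c *: commutator D D1 S x + commutator D D2 S x) //.
rewrite /commutator -fsum_linear; [|exact: commutator_finsupp..].
apply: eq_fsbigr => Q _; rewrite /comm.
rewrite -[(c *: D1 + D2) _ _]/(c *: D1 (S - Q) _ + D2 (S - Q) _).
rewrite -[(c *: D1 + D2) _ _]/(c *: D1 (S - Q) _ + D2 (S - Q) _).
rewrite (CoDer_linear Q DC) !scalerDr !scalerN !scalerA.
by rewrite opprD [c * _]mulrC addrACA.
Qed.

Definition concentrated Q D : Prop := forall R, R != Q -> D R = 0.

(** For homogeneous arguments the sum over all splittings of the weight has one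
    term. *)
Lemma commutator_concentrated Q R D D' : is_CoDer D -> is_CoDer D' ->
  concentrated Q D -> concentrated R D' ->
  concentrated (Q + R) (commutator D D') /\
  commutator D D' (Q + R) = comm Q R (D Q) (D' R).
Proof.
move=> DC DC' DQ DR'; split=> [S SQR|]; apply/funext => x; rewrite /commutator.
  rewrite fsbig1 // => P _; have [PQ|PQ] := eqVneq P Q; last first.
    by rewrite (DQ P PQ) comm0l //; exact: CoDer_linear.
  rewrite (DR' (S - P)) ?comm0r //; first exact: CoDer_linear.
  by rewrite PQ subr_eq addrC.
rewrite (@fsum_single _ _ _ _ Q) => [|P /eqP PQ].
  by rewrite addrC addKr.
by rewrite (DQ P PQ) comm0l //; exact: CoDer_linear.
Qed.

Lemma concentrated_eq Q D D' : concentrated Q D -> concentrated Q D' ->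
  D Q = D' Q -> D = D'.
Proof.
move=> DQ DQ' DD'; apply/funext => R; have [->//|RQ] := eqVneq R Q.
by rewrite DQ // DQ'.
Qed.

Lemma commutator_antisym Q R D D' : is_CoDer D -> is_CoDer D' ->
  concentrated Q D -> concentrated R D' ->
  commutator D D' = - (sg Q R *: commutator D' D).
Proof.
move=> DC DC' DQ DR'.
have [c1 e1] := commutator_concentrated DC DC' DQ DR'.
have [c2 e2] := commutator_concentrated DC' DC DR' DQ.
apply: (concentrated_eq c1) => [S SQR|].
  change (- (sg Q R *: commutator D' D S) = 0).
  by rewrite c2 1?addrC // scaler0 oppr0.
change (commutator D D' (Q + R) = - (sg Q R *: commutator D' D (Q + R))).
rewrite e1 [Q + R]addrC e2; apply/funext => x.
change (comm Q R (D Q) (D' R) x = - (sg Q R *: comm R Q (D' R) (D Q) x)).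
rewrite /comm -/(sg Q R) -/(sg R Q) [sg R Q]sgC scalerBr scalerA sg_sqr scale1r.
by rewrite opprB.
Qed.

Lemma comm_jacobi P Q R (f g h : T -> T) : linear f -> linear g -> linear h ->
  comm P (Q + R) f (comm Q R g h) =
    (fun x => comm (P + Q) R (comm P Q f g) h x
      + sg P Q *: comm Q (P + R) g (comm P R f h) x).
Proof.
move=> fL gL hL; apply/funext => x; rewrite /comm -!/(sg _ _).
rewrite !(linear_funB fL) !(linear_funB gL) !(linear_funB hL).
rewrite !(linear_funZ fL) !(linear_funZ gL) !(linear_funZ hL).
rewrite !sgDr !sgDl ![sg Q P]sgC !scalerBr !scalerA mulrA sg_sqr mul1r.
rewrite [sg Q R * sg P R]mulrC [_ * sg Q R * sg P Q]mulrC !mulrA !opprB !addrA.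
(* The last two pairs on the right are g f h and h f g with opposite signs. *)
by rewrite [RHS](ACl (1 * 8 * 3 * 6 * 2 * 5 * 4 * 7))%AC /= !subrK.
Qed.

Lemma commutator_jacobi P Q R D1 D2 D3 :
  is_CoDer D1 -> is_CoDer D2 -> is_CoDer D3 ->
  concentrated P D1 -> concentrated Q D2 -> concentrated R D3 ->
  commutator D1 (commutator D2 D3) =
    commutator (commutator D1 D2) D3
    + sg P Q *: commutator D2 (commutator D1 D3).
Proof.
move=> C1 C2 C3 d1 d2 d3.
have [d23 e23] := commutator_concentrated C2 C3 d2 d3.
have [d12 e12] := commutator_concentrated C1 C2 d1 d2.
have [d13 e13] := commutator_concentrated C1 C3 d1 d3.
have C23 := commutator_CoDer C2 C3; have C12 := commutator_CoDer C1 C2.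
have C13 := commutator_CoDer C1 C3.
have [dL eL] := commutator_concentrated C1 C23 d1 d23.
have [dR eR] := commutator_concentrated C12 C3 d12 d3.
have [dS eS] := commutator_concentrated C2 C13 d2 d13.
apply: (concentrated_eq dL) => [S SQR|].
  change (commutator (commutator D1 D2) D3 S
    + sg P Q *: commutator D2 (commutator D1 D3) S = 0).
  by rewrite dR 1?dS ?scaler0 ?addr0 // 1?addrCA // -addrA.
change (commutator D1 (commutator D2 D3) (P + (Q + R)) =
  commutator (commutator D1 D2) D3 (P + (Q + R))
    + sg P Q *: commutator D2 (commutator D1 D3) (P + (Q + R))).
rewrite eL [X in commutator (commutator _ _) _ X]addrA eR addrCA eS e23 e12 e13.
by rewrite comm_jacobi //; exact: CoDer_linear.
Qed.
End Commutator.

(** * The transported bracket *)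

Section Lie.
Variables (K : fieldType) (n : nat) (V : gradedVect K n.+1).
Local Notation Z := 'rV[int]_n.+1.
Local Notation W := (desusp V).
Local Notation L := (Z * W)%type.
Local Notation T := (tens_alg W).
Local Notation sg := (@sg K n.+1).
Local Notation word := (@word K n.+1 W).
Implicit Types (pi rho : C V).

Lemma Ccomp_Cdeg pi Q : Cdeg Q (Ccomp pi Q).
Proof. by case: pi => p /= /asboolP[]. Qed.

Lemma phi_coder pi Q : is_coder Q (phi pi Q).
Proof. exact: (phi_degP (Ccomp_Cdeg pi Q)).1. Qed.

Lemma phi_corestr pi Q h : homog_word h ->
  corestr (phi pi Q (word h)) = corestr_of (Ccomp pi Q) h.
Proof. exact: phi_deg_corestr (Ccomp_Cdeg pi Q). Qed.

Lemma corestr_of_lin c (p r : nat -> seq V -> V) h :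
  corestr_of (c *: p + r) h = c *: corestr_of p h + corestr_of r h.
Proof.
rewrite /corestr_of -[(c *: p + r) _ _]/(c *: p _ _ + r _ _).
by rewrite scalerDr !scalerA mulrC.
Qed.

Lemma phi_linear : linear (@phi K n V).
Proof.
move=> c pi rho; apply/funext => Q.
apply: phi_deg_unique => [|| h hh].
- exact: Ccomp_Cdeg.
- exact: is_coder_lin (phi_coder pi Q) (phi_coder rho Q).
rewrite -[Ccomp _ Q]/(c *: Ccomp pi Q + Ccomp rho Q) corestr_of_lin.
rewrite -[(c *: _ + _) _ _]/(c *: phi pi Q (word h) + phi rho Q (word h)).
by rewrite (@corestr_linear _ W) !phi_corestr.
Qed.

Lemma phi_eq pi rho Q : phi pi Q = phi rho Q -> Ccomp pi Q = Ccomp rho Q.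
Proof.
move=> pr; apply: (corestr_of_inj (Ccomp_Cdeg pi Q) (Ccomp_Cdeg rho Q)) => h hh.
by rewrite -!phi_corestr // pr.
Qed.

Lemma phi_inj : injective (@phi K n V).
Proof.
move=> pi rho pr; apply/val_inj/funext => Q /=.
by apply: phi_eq; rewrite pr.
Qed.

(** Makes phi preserve finite supports, and homogeneity in both directions. *)
Lemma phi_eq0 pi Q : Ccomp pi Q = 0 <-> phi pi Q = 0.
Proof.
have p0 : phi (0 : C V) Q = 0 by rewrite (linear_fun0 phi_linear).
split=> [pQ|pQ]; last by apply: (phi_eq (rho := 0)); rewrite pQ p0.
by rewrite -p0 /phi pQ.
Qed.

Lemma phi_CoDer pi : is_CoDer (phi pi).
Proof.
split=> [Q|]; first exact: phi_coder.
have : finsupp (Ccomp pi) by case: (pi) => p /= /asboolP[].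
by apply: sub_finite_set => Q /= pQ p0; apply: pQ; apply/phi_eq0.
Qed.

Lemma phi_surj D : is_CoDer D -> exists pi : C V, phi pi = D.
Proof.
move=> DC.
have /choice[p pE] : forall Q, exists pi : nat -> seq V -> V, Cdeg Q pi /\
    forall h, homog_word h -> corestr (D Q (word h)) = corestr_of pi h.
  by move=> Q; have [pi piC piE] := coder_has_corestr (DC.1 Q); exists pi.
have Cdeg0 Q : Cdeg Q (0 : nat -> seq V -> V).
  by move=> a; case: (Mult_submodule V (Q - e1 n *+ a) a).
have pC : p \in @Cin K n V.
  apply/asboolP; split=> [Q|]; first by case: (pE Q).
  apply: sub_finite_set DC.2 => Q /= pQ DQ; apply: pQ.
  have [pC pD] := pE Q; apply: (corestr_of_inj pC (Cdeg0 Q)) => h hh.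
  rewrite -pD // DQ -[0 _]/(0 : T) (linear_fun0 (@corestr_linear _ W)).
  by rewrite /corestr_of scaler0.
exists (CType pC); apply/funext => Q; have [pQ pD] := pE Q.
by apply: phi_deg_unique => //; case: DC.
Qed.

Lemma phi_is_isomorphism : phi_isomorphism V.
Proof.
split=> [||D /phi_surj[pi piD]]; [exact: phi_linear|exact: phi_CoDer|].
by exists pi; split=> // rho rhoD; apply: phi_inj; rewrite piD rhoD.
Qed.

Lemma phi_bracket pi rho :
  phi (bracket pi rho) = commutator (phi pi) (phi rho).
Proof.
have := commutator_CoDer (phi_CoDer pi) (phi_CoDer rho).
move=> /phi_surj; exact: (@xgetPex (C V : choiceType) 0).
Qed.

Lemma phi_concentrated Q pi : homog (g := C V) Q pi <-> concentrated Q (phi pi).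
Proof.
by split=> piQ R RQ; [apply/phi_eq0|apply/phi_eq0]; apply: piQ.
Qed.

Lemma bracket_homog Q R pi rho : homog (g := C V) Q pi ->
  homog (g := C V) R rho -> homog (g := C V) (Q + R) (bracket pi rho).
Proof.
move=> /phi_concentrated piQ /phi_concentrated rhoR; apply/phi_concentrated.
rewrite phi_bracket.
by case: (commutator_concentrated (phi_CoDer pi) (phi_CoDer rho) piQ rhoR).
Qed.

Lemma bracket_gradedLie : is_gradedLie (@bracket K n V).
Proof.
split.
- move=> z c x y; apply: phi_inj; rewrite phi_linear !phi_bracket phi_linear.
  by apply: commutator_linearl; exact: phi_CoDer.
- move=> z c x y; apply: phi_inj; rewrite phi_linear !phi_bracket phi_linear.
  by apply: commutator_linearr; exact: phi_CoDer.
- by move=> a b x y; exact: bracket_homog.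
- move=> a b x y /phi_concentrated xa /phi_concentrated yb; apply: phi_inj.
  rewrite -scaleN1r (linear_funZ phi_linear) scaleN1r (linear_funZ phi_linear).
  rewrite !phi_bracket.
  by apply: commutator_antisym; [exact: phi_CoDer..| |].
- move=> a b c x y z /phi_concentrated xa /phi_concentrated yb.
  move=> /phi_concentrated zc; apply: phi_inj.
  rewrite (linear_funD phi_linear) (linear_funZ phi_linear) !phi_bracket.
  by apply: (commutator_jacobi _ _ _ xa yb zc); exact: phi_CoDer.
Qed.
End Lie.

(** * Components of the bracket *)

Section Supports.
Variables (K : fieldType) (m : nat) (W : gradedVect K m).
Local Notation Z := 'rV[int]_m.
Local Notation L := (Z * W)%type.
Variable E : lmodType K.
Implicit Types (q : seq L -> W) (F : seq L -> E).

(** If F sees only words of length k - i and q only words of length l - j, then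
    the sum vanishes unless q, replacing l - j letters of w by one, produces
    length k - i.  The offsets i and j count the letters already fixed by the
    recursion. *)
Lemma coder_word_size Q q w F i j k l :
  (forall v, (size v + i)%N <> k -> F v = 0) ->
  (forall v, (size v + j)%N <> l -> q v = 0) ->
  dmultilinear F -> (k + l)%N <> (size w + 1 + i + j)%N -> coder_word Q q w F = 0.
Proof.
elim: w Q q F i j => //= x w IH Q q F i j Fk ql FM kl.
rewrite (IH _ _ _ i.+1 j) ?(IH _ _ _ i j.+1) ?scaler0 ?addr0 //.
- have [l1|l1] := (size [:: x] + j)%N =P l; last first.
    by rewrite ql //; apply: (@dmultilinear0 _ _ W _ F [::]).
  by apply: Fk => /= k1; apply: kl; rewrite -k1 -l1 /=; lia.
- by move=> v vl; apply: ql; rewrite /= addSnnS.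
- by lia.
- by move=> v vk; apply: Fk; rewrite /= addSnnS.
- exact: dmultilinear_cons.
- by lia.
Qed.

Lemma coder_word_ext_corestr Q q r w F :
  (forall v, (size v <= size w)%N -> q v = r v) -> coder_word Q q w F = coder_word Q r w F.
Proof.
elim: w Q q r F => //= x w IH Q q r F qr; rewrite qr //.
rewrite (IH Q q r) => [|v vw]; last by apply: qr; apply: leqW.
by rewrite (IH (Q + x.1) _ (fun v => r (x :: v))) // => v vw; apply: qr.
Qed.

Lemma coder_word_sum (I : Type) (s : seq I) Q q w (F : I -> seq L -> E) :
  coder_word Q q w (fun v => \sum_(a <- s) F a v) = \sum_(a <- s) coder_word Q q w (F a).
Proof.
elim: s => [|a s IH].
  rewrite big_nil -[RHS](coder_word0 E Q q w).
  by apply: eq_coder_word => v; rewrite big_nil.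
rewrite big_cons -IH -coder_wordD.
by apply: eq_coder_word => v; rewrite big_cons.
Qed.

Lemma coder_word_sum_corestr (I : Type) (s : seq I) Q (q : I -> seq L -> W) w F :
  dmultilinear F ->
  coder_word Q (fun v => \sum_(b <- s) q b v) w F =
    \sum_(b <- s) coder_word Q (q b) w F.
Proof.
move=> FM; elim: s => [|b s IH].
  rewrite big_nil -[RHS](addNr (coder_word Q (fun=> 0) w F)) -scaleN1r.
  rewrite -coder_word_linear_corestr //.
  by apply: coder_word_ext_corestr => v _; rewrite big_nil scaler0 addr0.
rewrite big_cons -IH -[coder_word Q (q b) w F]scale1r -coder_word_linear_corestr //.
by apply: coder_word_ext_corestr => v _; rewrite big_cons scale1r.
Qed.
End Supports.

Section Formula.
Variables (K : fieldType) (n : nat) (V : gradedVect K n.+1).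
Local Notation Z := 'rV[int]_n.+1.
Local Notation W := (desusp V).
Local Notation L := (Z * W)%type.
Local Notation T := (tens_alg W).
Local Notation sg := (@sg K n.+1).
Local Notation word := (@word K n.+1 W).
Local Notation e1 := (e1 n).
Implicit Types (p r : nat -> seq V -> V) (f g : seq V -> V).

Definition single (a : nat) (f : seq V -> V) : nat -> seq V -> V :=
  fun b => if b == a then f else 0.

Lemma single_Cdeg Q a f : Mult (Q - e1 *+ a) a f -> Cdeg Q (single a f).
Proof.
move=> fM b; rewrite /single; case: eqP => [->//|_].
by case: (Mult_submodule V (Q - e1 *+ b) b).
Qed.

Lemma phi_deg_word Q p h : Cdeg Q p -> homog_word h ->
  phi_deg Q p (word h) = coder_word Q (corestr_of p) h word.
Proof.
move=> pC hh; have := coder_exists (corestr_of_dmultilinear pC) (corestr_of_weighted pC).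
move=> [D [DC DE Dc]]; rewrite -DE //; congr (_ (word h)).
apply: (phi_deg_unique pC DC) => u hu.
by apply: (coder_corestr DC) => //; apply/has_corestr_homog_word.
Qed.

Lemma corestr_phi_phi Q R p r h : Cdeg Q p -> Cdeg R r -> homog_word h ->
  corestr (phi_deg Q p (phi_deg R r (word h))) =
    coder_word R (corestr_of r) h (corestr_of p).
Proof.
move=> pC rC hh; have [[PL _ _] _] := phi_degP pC.
rewrite (phi_deg_word rC) // (coder_word_map _ _ _ _ PL).
rewrite (coder_word_map _ _ _ _ (@corestr_linear _ W)).
apply: coder_word_ext => v _ _ _ /(_ (corestr_of_weighted rC) hh) hv.
exact: phi_deg_corestr.
Qed.

Lemma corestr_of_single a f h : size h <> a.+1 -> f [::] = 0 ->
  corestr_of (single a f) h = 0.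
Proof.
move=> ha f0; rewrite /corestr_of /single; case: eqP => [ea|_].
  by case: h ha ea => [|l h] ha ea; [rewrite f0 scaler0|case: ha; rewrite -ea].
exact: scaler0.
Qed.

Lemma corestr_of_sum Q p c h : Cdeg Q p -> (size h <= c.+1)%N ->
  corestr_of p h = \sum_(a < c.+1) corestr_of (single a (p a)) h.
Proof.
move=> pC hc; have hc' : ((size h).-1 < c.+1)%N by lia.
rewrite (bigD1 (Ordinal hc')) //= big1 ?addr0 => [|a].
  by rewrite /corestr_of /single eqxx.
rewrite -val_eqE /= eq_sym => /negPf ah.
by rewrite /corestr_of /single ah; exact: scaler0.
Qed.

(** At a word of length c + 1 only components of arity at most c + 1
    matter, which makes the possibly infinite sequences finite sums. *)
Lemma coder_word_components Q R p r h c :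
  Cdeg Q p -> Cdeg R r -> size h = c.+1 ->
  coder_word R (corestr_of r) h (corestr_of p) =
  \sum_(a < c.+1) \sum_(b < c.+1)
    coder_word R (corestr_of (single b (r b))) h (corestr_of (single a (p a))).
Proof.
move=> pC rC hc.
transitivity (\sum_(a < c.+1)
    coder_word R (corestr_of r) h (corestr_of (single a (p a)))).
  rewrite -coder_word_sum; apply: coder_word_ext => v _ vh _ _.
  by apply: corestr_of_sum pC _; rewrite -hc.
apply: eq_bigr => a _; rewrite -coder_word_sum_corestr; last first.
  exact: corestr_of_dmultilinear (single_Cdeg (pC a)).
apply: coder_word_ext_corestr => v vh.
by apply: corestr_of_sum rC _; rewrite -hc.
Qed.

Section Components.
Variables (Q R : Z) (p r : nat -> seq V -> V).
Hypotheses (pC : Cdeg Q p) (rC : Cdeg R r).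

Let pS a : Cdeg Q (single a (p a)) := single_Cdeg (pC a).
Let rS b : Cdeg R (single b (r b)) := single_Cdeg (rC b).

Definition comm_component a b : T -> T :=
  comm Q R (phi_deg Q (single a (p a))) (phi_deg R (single b (r b))).

Lemma corestr_comm Q' R' p' r' h : Cdeg Q' p' -> Cdeg R' r' -> homog_word h ->
  corestr (comm Q' R' (phi_deg Q' p') (phi_deg R' r') (word h)) =
    coder_word R' (corestr_of r') h (corestr_of p')
    - sg Q' R' *: coder_word Q' (corestr_of p') h (corestr_of r').
Proof.
move=> pC' rC' hh; rewrite /comm (linear_funB (@corestr_linear _ W)).
rewrite (linear_funZ (@corestr_linear _ W)).
by rewrite (corestr_phi_phi pC' rC' hh) (corestr_phi_phi rC' pC' hh).
Qed.

Lemma comm_component_coder a b : is_coder (Q + R) (comm_component a b).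
Proof. by apply: comm_coder; apply: (phi_degP _).1. Qed.

Lemma comm_component_size a b h : homog_word h -> size h <> (a + b).+1 ->
  corestr (comm_component a b (word h)) = 0.
Proof.
move=> hh hab; rewrite corestr_comm //.
have p0 v : (size v + 0)%N <> a.+1 -> corestr_of (single a (p a)) v = 0.
  rewrite addn0 => va; apply: corestr_of_single => //; exact: Mult_nil (pC a).
have r0 v : (size v + 0)%N <> b.+1 -> corestr_of (single b (r b)) v = 0.
  rewrite addn0 => vb; apply: corestr_of_single => //; exact: Mult_nil (rC b).
rewrite (coder_word_size _ p0 r0); last by lia.
  rewrite (coder_word_size _ r0 p0); last by lia.
    by rewrite scaler0 subrr.
  exact: corestr_of_dmultilinear (rS b).
exact: corestr_of_dmultilinear (pS a).
Qed.

Lemma corestr_comm_sum c h : homog_word h -> size h = c.+1 ->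
  corestr (comm Q R (phi_deg Q p) (phi_deg R r) (word h)) =
    \sum_(a < c.+1) corestr (comm_component a (c - a) (word h)).
Proof.
move=> hh hc; rewrite corestr_comm //.
rewrite (coder_word_components pC rC hc) (coder_word_components rC pC hc).
rewrite [X in _ *: X]exchange_big /=.
rewrite scaler_sumr -sumrB; apply: eq_bigr => a _.
rewrite scaler_sumr -sumrB.
under eq_bigr => b _ do rewrite -(corestr_comm (pS a) (rS b) hh).
have ca : (c - a < c.+1)%N by rewrite ltnS leq_subr.
rewrite (bigD1 (Ordinal ca)) //= big1 ?addr0 // => b bca.
apply: comm_component_size => // hab; case/eqP: bca; apply: val_inj => /=.
by move: hab; rewrite hc; lia.
Qed.

(** The stem bracket of the two components up to its sign. *)
Definition stem_component a b : seq V -> V :=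
  phi_stem_inv (Q - e1 *+ a + (R - e1 *+ b)) (a + b) (comm_component a b).

Lemma stem_weight a b :
  Q - e1 *+ a + (R - e1 *+ b) = Q + R - e1 *+ (a + b).
Proof. by rewrite mulrnDr opprD addrACA. Qed.

(** The corestrictions of the commutator vanish off arity a + b + 1, so it is
    the coderivation of a single multilinear map. *)
Lemma stem_componentP a b :
  Mult (Q + R - e1 *+ (a + b)) (a + b) (stem_component a b) /\
  phi_deg (Q + R) (single (a + b) (stem_component a b)) = comm_component a b.
Proof.
have [mu muC muE] := coder_has_corestr (comm_component_coder a b).
have : exists f, Mult (Q + R - e1 *+ (a + b)) (a + b) f /\
    phi_deg (Q + R) (single (a + b) f) = comm_component a b.
  exists (mu (a + b)%N); split=> //.
  apply: phi_deg_unique (comm_component_coder a b) _ => [|h hh].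
    exact: single_Cdeg.
  have [hab|hab] := size h =P (a + b).+1.
    by rewrite muE // /corestr_of /single hab /= eqxx.
  rewrite comm_component_size // corestr_of_single //.
  exact: Mult_nil (muC _).
move=> /(@xgetPex (seq V -> V : choiceType) 0).
rewrite /stem_component /phi_stem_inv stem_weight.
by rewrite /phi_stem subrK.
Qed.

Lemma stem_component_Mult c a : (a <= c)%N ->
  Mult (Q + R - e1 *+ c) c (stem_component a (c - a)).
Proof. by move=> ac; have [] := stem_componentP a (c - a); rewrite subnKC. Qed.

(** Both sides have the same corestrictions, length by length. *)
Lemma comm_phi_deg beta : Cdeg (Q + R) beta ->
  phi_deg (Q + R) beta = comm Q R (phi_deg Q p) (phi_deg R r) ->
  forall c, beta c = \sum_(a < c.+1) stem_component a (c - a).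
Proof.
move=> bC bE; pose gam c := \sum_(a < c.+1) stem_component a (c - a).
have gC : Cdeg (Q + R) gam.
  move=> c; apply: submodule_sum (Mult_submodule V _ _) _ => a _.
  by apply: stem_component_Mult; rewrite -ltnS.
suff -> : beta = gam by [].
apply: (corestr_of_inj bC gC) => h hh.
rewrite -(phi_deg_corestr bC hh) bE.
case sh : (size h) => [|c].
  case: h hh sh => // hh _; rewrite word_nil /comm.
  have [[PL _ _] _] := phi_degP pC; have [[RL _ _] _] := phi_degP rC.
  rewrite (linear_fun0 PL) (linear_fun0 RL) (linear_fun0 PL) scaler0 subr0.
  rewrite (linear_fun0 (@corestr_linear _ W)).
  by rewrite /corestr_of (Mult_nil (gC _)) scaler0.
rewrite (corestr_comm_sum hh sh) /corestr_of sh /= /gam.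
have sumE (s : seq 'I_c.+1) (F : 'I_c.+1 -> seq V -> V) w :
    (\sum_(a <- s) F a) w = \sum_(a <- s) F a w.
  elim: s => [|a s IH]; first by rewrite !big_nil.
  by rewrite !big_cons -IH.
rewrite sumE scaler_sumr; apply: eq_bigr => a _.
have ac : (a <= c)%N by rewrite -ltnS.
have [fM <-] := stem_componentP a (c - a).
rewrite phi_deg_corestr //; last exact: single_Cdeg.
by rewrite /corestr_of /single sh subnKC //= eqxx.
Qed.

Lemma stem_componentE a b :
  sgn K (1 + ip e1 R *+ a) *:
    stem (Q - e1 *+ a) a (R - e1 *+ b) b (p a) (r b) = stem_component a b.
Proof.
rewrite /stem /phi_stem !subrK [e1 *+ b + _]addrC subrK scalerA.
have -> : ip (e1 *+ a) R = ip e1 R *+ a.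
  elim: a => [|a IH]; first by rewrite /ip big1 // => i _; rewrite mxE mul0r.
  by rewrite !mulrS ipDl IH.
by rewrite sgn_sqr scale1r.
Qed.
End Components.
End Formula.

Theorem proposition5 (K : fieldType) (charK : [pchar K] =i pred0)
    (n : nat) (V : gradedVect K n.+1) :
  [/\ phi_isomorphism V,
      is_gradedLie (@bracket K n V),
      forall pi rho : C V,
        phi (bracket pi rho) = commutator (phi pi) (phi rho)
    & forall (Q R : 'rV[int]_n.+1) (pi rho : C V), homog Q pi -> homog R rho ->
        homog (Q + R) (bracket pi rho) /\
        forall c : nat,
          Ccomp (bracket pi rho) (Q + R) c =
            \sum_(a < c.+1)
              sgn K (1 + ip (e1 n) R *+ a) *:
                stem (Q - e1 n *+ a) a (R - e1 n *+ (c - a)) (c - a)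
                  (Ccomp pi Q a) (Ccomp rho R (c - a)%N)].
Proof.
split; [exact: phi_is_isomorphism|exact: bracket_gradedLie|exact: phi_bracket|].
move=> Q R pi rho piQ rhoR; split=> [|c]; first exact: bracket_homog.
under eq_bigr => a _ do rewrite stem_componentE.
apply: comm_phi_deg; [exact: Ccomp_Cdeg..|].
rewrite -/(phi (bracket pi rho) (Q + R)) phi_bracket.
have [_ ->//] := commutator_concentrated (phi_CoDer pi) (phi_CoDer rho)
  (iffLR (phi_concentrated Q pi) piQ) (iffLR (phi_concentrated R rho) rhoR).
Qed.
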